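(* For every non-negative real number $t$, $$ \lim_{d\rightarrow+\infty}d^2\bigl(I_{d+1}(t)-I_d(t)\bigr)=\frac{3\sqrt{6}\bigl(1-24t^2+48t^4\bigr)}{20\sqrt{\pi}\,e^{6t^2}}. $$
   Context: For a positive integer $d$ and a non-negative real number $t$, $I_d(t)$ denotes the $(d-1)$-dimensional volume of $H\cap[0,1]^d$ where $H$ is a hyperplane of $\mathbb{R}^d$ that is orthogonal to a diagonal of the hypercube $[0,1]^d$ (a segment joining two opposite vertices, for instance the one in direction $(1,\ldots,1)$) and whose Euclidean distance to the center of $[0,1]^d$ is equal to $t$. By symmetry, this does not depend on the choice of such an $H$. The volume is $0$ when the intersection is empty. *)

(* Defs.v *)
From HB Require Import structures.
From mathcomp Require Import all_boot all_order all_algebra.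
From mathcomp Require Import all_classical all_reals all_analysis.

Set Implicit Arguments.
Unset Strict Implicit.
Unset Printing Implicit Defensive.
Import Order.TTheory GRing.Theory Num.Theory.
Import numFieldNormedType.Exports.
Local Open Scope classical_set_scope.
Local Open Scope ring_scope.

Section LebesgueTuple.
Context {R : realType}.
Local Notation Rm := (measurableTypeR R).

Definition cons_pair n (p : Rm * n.-tuple Rm) : n.+1.-tuple Rm :=
  [tuple of p.1 :: p.2].

Lemma measurable_cons_pair n : measurable_fun setT (@cons_pair n).
Proof. exact: measurable_cons. Qed.

HB.instance Definition _ n := isMeasurableFun.Build _ _ _ _ (@cons_pair n)
  (@measurable_cons_pair n).

Section Cons.
Variables (n : nat) (mu : {sigma_finite_measure set (n.-tuple Rm) -> \bar R}).

Definition lebesgue_cons : set (n.+1.-tuple Rm) -> \bar R :=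
  pushforward (lebesgue_measure \x mu)%E (@cons_pair n).

Let lebesgue_cons0 : lebesgue_cons set0 = 0%E.
Proof. exact: measure0. Qed.

Let lebesgue_cons_ge0 A : (0 <= lebesgue_cons A)%E.
Proof. exact: measure_ge0. Qed.

Let lebesgue_cons_sigma_additive : semi_sigma_additive lebesgue_cons.
Proof. exact: measure_semi_sigma_additive. Qed.

HB.instance Definition _ := isMeasure.Build _ _ _ lebesgue_cons
  lebesgue_cons0 lebesgue_cons_ge0 lebesgue_cons_sigma_additive.

Let lebesgue_cons_sigma_finite : sigma_finite setT lebesgue_cons.
Proof.
have /sigma_finiteP[F [TF ndF Foo]] := sigma_finiteT (@lebesgue_measure R).
have /sigma_finiteP[G [TG ndG Goo]] := sigma_finiteT mu.
pose u (s : n.+1.-tuple Rm) : Rm * n.-tuple Rm := (thead s, [tuple of behead s]).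
have Ku : cancel (@cons_pair n) u.
  by move=> [x y]; congr pair; exact: val_inj.
have mfu : measurable_fun setT u.
  by apply/measurable_fun_pairP; split;
    [exact: measurable_tnth|exact: measurable_behead].
have mFG k : measurable (F k `*` G k).
  by have [? _] := Foo k; have [? _] := Goo k; exact: measurableX.
exists (fun k => u @^-1` (F k `*` G k)).
  rewrite -preimage_bigcup (_ : \bigcup_k _ = setT) ?preimage_setT//.
  rewrite -setXTT TF TG predeqE => -[x y]; split.
    by move=> [k _ []/= ? ?]; split; exists k.
  move=> [/= [k _ Fkx] [l _ Gly]]; exists (maxn k l) => //; split.
  - by move: x Fkx; exact/subsetPset/ndF/leq_maxl.
  - by move: y Gly; exact/subsetPset/ndG/leq_maxr.
move=> k; split; first by rewrite -[X in measurable X]setTI; exact: mfu.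
rewrite /lebesgue_cons /pushforward -comp_preimage.
rewrite (_ : u \o _ = id) ?preimage_id; last by apply/funext => p /=; rewrite Ku.
have [? ?] := Foo k; have [? ?] := Goo k.
by rewrite product_measure1E// lte_mul_pinfty// ge0_fin_numE.
Qed.

HB.instance Definition _ := Measure_isSigmaFinite.Build _ _ _ lebesgue_cons
  lebesgue_cons_sigma_finite.

End Cons.

Fixpoint lebesgue_tuple n : {sigma_finite_measure set (n.-tuple Rm) -> \bar R} :=
  match n with
  | 0 => \d_([tuple] : 0.-tuple Rm)
  | m.+1 => lebesgue_cons (lebesgue_tuple m)
  end.

End LebesgueTuple.

Section Sections.
Context {R : realType}.

Definition lebesgue_rV n (A : set 'rV[R]_n) : \bar R :=
  lebesgue_tuple n [set s | A (\row_i tnth s i)].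

Definition dotprod n (x y : 'rV[R]_n) : R := \sum_i x 0 i * y 0 i.

(* The canonical norm [`|x|] on ['rV[R]_n] is the sup norm. *)
Definition eucl_norm n (x : 'rV[R]_n) : R := Num.sqrt (dotprod x x).

Definition eucl_dist n (x : 'rV[R]_n) (A : set 'rV[R]_n) : R :=
  inf [set eucl_norm (x - y) | y in A].

Definition isometric m n (f : 'rV[R]_m -> 'rV[R]_n) : Prop :=
  forall x y, eucl_norm (f x - f y) = eucl_norm (x - y).

Definition hyperplane_orthogonal_to n (a : 'rV[R]_n) (H : set 'rV[R]_n) : Prop :=
  a != 0 /\ exists b, H = [set x | dotprod x a = b].

(* (n-1)-dimensional volume of a subset [A] of the hyperplane [H]: the Lebesgue
   measure of [A] read in an isometric parametrization of [H] by R^(n-1), on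
   the choice of which it does not depend.  For n = 1 it counts points. *)
Definition hyperplane_volume n (H A : set 'rV[R]_n) : R :=
  fine (xget 0%E [set v | exists f : 'rV[R]_n.-1 -> 'rV[R]_n,
    [/\ isometric f, range f = H & v = lebesgue_rV (f @^-1` A)]]).

Definition cube n : set 'rV[R]_n := [set x | forall i, 0 <= x 0 i <= 1].

Definition cube_center n : 'rV[R]_n := const_mx 2^-1.

Definition cube_vertex n (v : 'rV[R]_n) : Prop :=
  forall i, v 0 i = 0 \/ v 0 i = 1.

Definition opposite_vertex n (v : 'rV[R]_n) : 'rV[R]_n := const_mx 1 - v.

Definition diagonal_hyperplane n (H : set 'rV[R]_n) : Prop :=
  exists2 v, cube_vertex v & hyperplane_orthogonal_to (opposite_vertex v - v) H.

(* [v] is I_d(t), computed on some hyperplane among the admissible ones. *)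
Definition diagonal_section_volume d (t v : R) : Prop :=
  exists H : set 'rV[R]_d, [/\ diagonal_hyperplane H,
    eucl_dist (@cube_center d) H = t & v = hyperplane_volume H (H `&` @cube d)].

End Sections.

(* Main.v *)
Require Import Defs.
From HB Require Import structures.
From mathcomp Require Import all_boot all_order all_algebra.
From mathcomp Require Import all_classical all_reals all_analysis.
From mathcomp Require Import measurable_realfun ring lra.
Import Order.TTheory GRing.Theory Num.Theory.
Import numFieldNormedType.Exports.
Local Open Scope classical_set_scope.
Local Open Scope ring_scope.
Set Implicit Arguments.
Unset Strict Implicit.
Unset Printing Implicit Defensive.

(** Let [a] be a vector with entries [1] and [-1].  On a hyperplane orthogonal to
    [a], the dot product with [a] differs from its value at the center of the cube
    by some [s], whose absolute value is [sqrt d] times the distance [t] to the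
    center.  The proof rests on a Fourier formula for the section of the cube,
    [[
      I_d(t) = 2 / pi * \int_0^oo sinc (v / sqrt d) ^ d * cos (2 * t * v) dv
    ]]
    with [sinc x = sin x / x], and on an asymptotic expansion of this integral in
    powers of [1 / d].

    Geometry.  The volume of the section is defined through an isometric
    parametrization of the hyperplane.  Such a parametrization, followed by
    displacements along the unit normal, is an isometry of the whole space, and
    isometries preserve Lebesgue measure ([isometric_lebesgue]) because
    translation-invariant measures are proportional
    ([translation_invariant_unique]).  The volume of a slab of thickness 1 over
    the section is therefore the volume of the section; computing that of the
    slab by slices along the first axis replaces the parametrization by the
    projection along this axis, at the cost of a factor [sqrt d]
    ([isometric_hyperplane_cube], [diagonal_section_volumeE]).

    Fourier.  After this projection the section is the part of a cube of
    dimension [d - 1] where a signed sum of the centered coordinates is within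
    [1 / 2] of [s].  Adding a coordinate averages its measure over a unit
    interval of values of [s], which multiplies the Fourier transform by
    [sinc (u / 2)]; the induction starts from the hat function, whose transform
    is [sinc (u / 2) ^ 2] ([lebesgue_cube_slice]).  The substitution
    [u = 2 * v / sqrt d] gives the formula above, where [s] has been replaced by
    [sqrt d * t] ([section_volume_integral]).

    Asymptotics.  Since [- ln (sinc w) = w^2/6 + w^4/180 + w^6/2835 + O(w^8)],
    [[
      sinc (v / sqrt d) ^ d = exp (- v^2/6) * (1 - v^4/(180 d) + p(v)/d^2) + R
    ]]
    with [p] a polynomial and [R] at most [1 / d^3] times a fixed integrable
    function of [v] ([sinc_pow_expansion]).  So [I_d(t) = c0 - c1/d + c2/d^2 +
    O(1/d^3)], and [d^2 * (I_(d+1)(t) - I_d(t))] tends to [c1]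
    ([cvg_of_expansion]), which is [2 / (180 * pi)] times the integral of
    [v^4 * exp (- v^2/6) * cos (2 * t * v)] over the half-line.  This Gaussian
    moment is explicit ([cos_moment4E]). *)

(** * Lebesgue measure on tuples *)

Section LebesgueTupleTheory.
Context {R : realType}.
Local Notation Rm := (measurableTypeR R).
Local Notation lam := (@lebesgue_tuple R).

Definition shift_tuple n (w x : n.-tuple Rm) : n.-tuple Rm :=
  [tuple tnth x i + tnth w i | i < n].

Lemma measurable_tuple_of d (T : measurableType d) n (f : T -> 'I_n -> R) :
  (forall i, measurable_fun setT (f ^~ i)) ->
  measurable_fun setT (fun x => [tuple f x i | i < n] : n.-tuple Rm).
Proof.
move=> mf; apply/measurable_fun_tnthP => i.
have -> : (tnth (T:=Rm))^~ i \o (fun x => [tuple f x i | i < n]) = f ^~ i.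
  by apply/funext => x /=; rewrite tnth_mktuple.
exact: mf.
Qed.

Lemma measurable_coord n (i : 'I_n) :
  measurable_fun setT (fun x : n.-tuple Rm => tnth x i : R).
Proof. exact: measurable_tnth. Qed.

Lemma lebesgue_tupleS n (A : set (n.+1.-tuple Rm)) :
  lam n.+1 A = (lebesgue_measure \x lam n)%E (@cons_pair R n @^-1` A).
Proof. by []. Qed.

Lemma lebesgue_tupleSE n (A : set (n.+1.-tuple Rm)) :
  lam n.+1 A = (\int[lebesgue_measure]_x lam n [set y | A (cons_pair (x, y))])%E.
Proof.
rewrite lebesgue_tupleS /product_measure1; apply: eq_integral => x _ /=.
by congr (lam n _); apply/seteqP; split=> y; rewrite /xsection/= inE.
Qed.

(** Slicing in the other order defines a measure that agrees with the product
    measure on rectangles, hence everywhere. *)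
Lemma lebesgue_tuple_fubini n (A : set (n.+1.-tuple Rm)) : measurable A ->
  lam n.+1 A = (\int[lam n]_y lebesgue_measure [set x | A (cons_pair (x, y))])%E.
Proof.
move=> mA; rewrite lebesgue_tupleS.
have mA' : measurable (@cons_pair R n @^-1` A).
  by rewrite -[X in measurable X]setTI; exact: measurable_cons_pair.
rewrite (product_measure_unique (m' := product_measure2 lebesgue_measure (lam n))) //.
- rewrite /product_measure2; apply: eq_integral => y _ /=.
  by congr lebesgue_measure; apply/seteqP; split=> x; rewrite /ysection/= inE.
- by move=> X Y mX mY; exact: product_measure2E.
Qed.

Lemma lebesgue_measure_shift (h : R) (A : set R) : measurable A ->
  lebesgue_measure ((fun x : Rm => x + h) @^-1` A) = lebesgue_measure A.
Proof.
move=> mA.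
have mf : measurable_fun setT (fun x : Rm => x + h : Rm).
  by apply: measurable_funD.
pose f : {mfun Rm >-> Rm} := HB.pack (fun x : Rm => x + h : Rm)
   (isMeasurableFun.Build _ _ _ _ _ mf).
apply/esym/(lebesgue_measure_unique (mu := pushforward lebesgue_measure f)) => //.
move=> _ [[a b]] _ <-.
transitivity (lebesgue_measure `]a - h, b - h]%classic); last first.
  congr lebesgue_measure.
  by apply/seteqP; split=> x /=; rewrite !in_itv/= ltrBlDr lerBrDr.
rewrite !lebesgue_measure_itv/= !lte_fin ltrD2r.
by case: ifPn => // _; rewrite -!EFinB opprB addrA subrK.
Qed.

Lemma lebesgue_measure_scale (c : R) (A : set R) : 0 < c -> measurable A ->
  (c%:E * lebesgue_measure ((fun x : Rm => (c * x)%R) @^-1` A))%E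
  = lebesgue_measure A.
Proof.
move=> c0 mA.
have mf : measurable_fun setT (fun x : Rm => c * x : Rm).
  by apply: measurable_funM.
pose f : {mfun Rm >-> Rm} := HB.pack (fun x : Rm => c * x : Rm)
   (isMeasurableFun.Build _ _ _ _ _ mf).
have c0' : 0 <= c by exact: ltW.
apply/esym/(lebesgue_measure_unique (mu := mscale (NngNum c0') (pushforward lebesgue_measure f))) => //.
move=> _ [[a b]] _ <-.
transitivity (c%:E * lebesgue_measure (`](a / c)%R, (b / c)%R]%classic : set R))%E; last first.
  congr (_ * lebesgue_measure _)%E.
  by apply/seteqP; split=> x /=; rewrite !in_itv/= ltr_pdivrMr// ler_pdivlMr// mulrC.
rewrite !lebesgue_measure_itv/= !lte_fin ltr_pM2r ?invr_gt0//.
case: ifPn => // _; last by rewrite mule0.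
by rewrite -!EFinB -EFinM; congr EFin; field; exact: lt0r_neq0.
Qed.

Lemma shift_tuple_cons n (w : n.+1.-tuple Rm) (p : Rm * n.-tuple Rm) :
  shift_tuple w (cons_pair p) =
  cons_pair (p.1 + thead w : R, shift_tuple [tuple of behead w] p.2).
Proof.
apply/eq_from_tnth => i; rewrite tnth_mktuple.
case: (unliftP ord0 i) => [j ->|->]; last by rewrite !tnth0.
by rewrite !tnthS tnth_mktuple; congr (_ + _); rewrite [in LHS](tuple_eta w) tnthS.
Qed.

(** One coordinate at a time: the tail by induction, with the head fixed; the
    head by slicing in the other order, where the one-dimensional invariance
    applies. *)
Lemma lebesgue_tuple_shift n (w : n.-tuple Rm) (A : set (n.-tuple Rm)) :
  measurable A -> lam n (shift_tuple w @^-1` A) = lam n A.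
Proof.
elim: n w A => [|n IH] w A mA.
  congr (lam 0 _); apply/seteqP; split=> x /=;
    by rewrite (tuple0 x) (tuple0 (shift_tuple _ _)).
have mh : measurable_fun setT
    (fun x : n.+1.-tuple Rm => cons_pair (thead x + thead w : R, [tuple of behead x])).
  apply: (@measurable_cons _ _ _ Rm (fun x : n.+1.-tuple Rm => thead x + thead w : R)
    n (fun x => [tuple of behead x])).
    by apply: measurable_funD => //; exact: measurable_coord.
  exact: measurable_behead.
pose B : set (n.+1.-tuple Rm) :=
  [set x | A (cons_pair (thead x + thead w : R, [tuple of behead x]))].
have mB : measurable B by rewrite -[X in measurable X]setTI; exact: mh.
have BE x y : B (cons_pair (x, y)) = A (cons_pair (x + thead w : R, y)).
  by rewrite /B/=; congr (A (cons_pair (_, _))); exact: val_inj.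
transitivity (lam n.+1 B).
  rewrite !lebesgue_tupleSE; apply: eq_integral => x _.
  rewrite -[RHS](IH [tuple of behead w]).
    congr (lam n _); apply/seteqP; split=> y /=; rewrite BE shift_tuple_cons//.
  have mc : measurable_fun setT (fun y : n.-tuple Rm => cons_pair (x : Rm, y)).
    exact: (@measurable_cons _ _ _ Rm (fun=> x) n id).
  by rewrite -[X in measurable X]setTI; apply: mc.
rewrite !lebesgue_tuple_fubini//; apply: eq_integral => y _.
rewrite -[RHS](lebesgue_measure_shift (thead w)).
  by congr lebesgue_measure; apply/seteqP; split=> x /=; rewrite BE.
have mc : measurable_fun setT (fun x : Rm => cons_pair (x : Rm, y)).
  exact: (@measurable_cons _ _ _ Rm id n (fun=> y)).
by rewrite -[X in measurable X]setTI; apply: mc.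
Qed.

End LebesgueTupleTheory.

(** * Uniqueness of translation-invariant measures *)

Section SectionsSwap.
Local Open Scope ereal_scope.
Context d1 d2 (T1 : measurableType d1) (T2 : measurableType d2) (R : realType).
Variables (m1 : {sigma_finite_measure set T1 -> \bar R})
          (m2 : {sigma_finite_measure set T2 -> \bar R}).

Lemma integral_sectionsC (S : set (T1 * T2)) : measurable S ->
  \int[m1]_x m2 [set y | S (x, y)] = \int[m2]_y m1 [set x | S (x, y)].
Proof.
move=> mS.
transitivity (product_measure1 m1 m2 S).
  apply: eq_integral => x _ /=.
  by congr (m2 _); apply/seteqP; split=> y; rewrite /xsection/= inE.
rewrite (product_measure_unique (m' := product_measure2 m1 m2)) //.
- rewrite /product_measure2; apply: eq_integral => y _ /=.
  by congr (m1 _); apply/seteqP; split=> x; rewrite /ysection/= inE.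
- by move=> X Y mX mY; exact: product_measure2E.
Qed.

(** The shape of most computations by slices: those over [P] all have the same
    measure, and the others are empty. *)
Lemma integral_indic_cst (P : set T1) (c : \bar R) (f : T1 -> \bar R) :
  measurable P -> 0 <= c ->
  (forall x, P x -> f x = c) -> (forall x, ~ P x -> f x = 0) ->
  \int[m1]_x f x = c * m1 P.
Proof.
move=> mP c0 fP fNP.
rewrite -integral_cst// integral_mkcond; apply: eq_integral => x _.
rewrite patchE; case: ifPn => [|/negP]; rewrite inE => /asboolP; rewrite asboolE.
  exact: fP.
exact: fNP.
Qed.

End SectionsSwap.

Section Uniqueness.
Context {R : realType}.
Local Notation Rm := (measurableTypeR R).
Local Notation lam := (@lebesgue_tuple R).

Definition opp_tuple n (w : n.-tuple Rm) : n.-tuple Rm :=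
  [tuple (- tnth w i : R) | i < n].

Lemma measurable_add_tuple n :
  measurable_fun setT (fun p : n.-tuple Rm * n.-tuple Rm => shift_tuple p.1 p.2).
Proof.
have := @measurable_tuple_of R _ (n.-tuple Rm * n.-tuple Rm)%type n
  (fun p i => tnth p.2 i + tnth p.1 i).
apply => i; apply: measurable_funD.
  exact: (measurableT_comp (measurable_coord i)).
exact: (measurableT_comp (measurable_coord i)).
Qed.

Lemma measurable_opp_tuple n :
  measurable_fun setT (@opp_tuple n).
Proof.
have := @measurable_tuple_of R _ (n.-tuple Rm)%type n (fun p i => - tnth p i).
apply => i; apply: measurableT_comp => //; exact: measurable_coord.
Qed.

Lemma measurable_preT d1 d2 (T1 : measurableType d1) (T2 : measurableType d2)
  (f : T1 -> T2) A : measurable_fun setT f -> measurable A -> measurable (f @^-1` A).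
Proof. by move=> mf mA; rewrite -[X in measurable X]setTI; exact: mf. Qed.

(** The left-hand side measures the pairs [(x, y)] with [x + y] in [A] and [y]
    in [Q].  For fixed [x], the translation [z = x + y] turns this into the pairs
    [(x, z)] with [z] in [A] and [z - x] in [Q]; for fixed [z] in [A], the set of
    such [x] is a translate of [Q] by symmetry.  Each step is a translation for
    one of the two measures only. *)
Lemma translation_invariant_unique n
    (mu : {sigma_finite_measure set (n.-tuple Rm) -> \bar R})
    (A Q : set (n.-tuple Rm)) :
  (forall w B, measurable B -> mu (shift_tuple w @^-1` B) = mu B) ->
  measurable A -> measurable Q -> (forall x, Q x -> Q (opp_tuple x)) ->
  (mu A * lam n Q = mu Q * lam n A)%E.
Proof.
move=> muS mA mQ QN.
have QNE x : Q (opp_tuple x) = Q x.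
  apply/propext; split; last exact: QN.
  move=> /QN; congr (Q _); apply/eq_from_tnth => i.
  by rewrite !tnth_mktuple opprK.
pose S1 : set (n.-tuple Rm * n.-tuple Rm) :=
  [set p | A (shift_tuple p.1 p.2) /\ Q p.2].
pose S2 : set (n.-tuple Rm * n.-tuple Rm) :=
  [set p | A p.2 /\ Q (shift_tuple (opp_tuple p.1) p.2)].
have mS1 : measurable S1.
  apply: measurableI; first exact: (measurable_preT (@measurable_add_tuple n)).
  by apply: measurable_preT mQ.
have mS2 : measurable S2.
  apply: measurableI; first by apply: measurable_preT mA.
  have mN : measurable_fun setT
      (fun p : n.-tuple Rm * n.-tuple Rm => (opp_tuple p.1, p.2)).
    apply/measurable_fun_pairP; split; last exact: measurable_snd.
    exact: (measurableT_comp (@measurable_opp_tuple n)).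
  exact: (measurable_preT (measurableT_comp (@measurable_add_tuple n) mN)).
transitivity (\int[mu]_x lam n [set y | S1 (x, y)])%E.
  rewrite integral_sectionsC//; apply/esym.
  apply: integral_indic_cst => //.
    move=> y Qy; rewrite -[RHS](muS y)//; congr (mu _); apply/seteqP.
    split=> x /=; rewrite /S1/=.
      by move=> [+ _]; congr (A _); apply/eq_from_tnth => i; rewrite !tnth_mktuple addrC.
    move=> Ayx; split=> //.
    by move: Ayx; congr (A _); apply/eq_from_tnth => i; rewrite !tnth_mktuple addrC.
  move=> y Qy; rewrite (_ : [set _ | _] = set0) ?measure0//.
  by apply/seteqP; split => // x [].
transitivity (\int[mu]_x lam n [set y | S2 (x, y)])%E.
  apply: eq_integral => x _.
  rewrite -[RHS](lebesgue_tuple_shift x).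
    rewrite /preimage/=; congr (lam n _); apply/seteqP.
    have E y : shift_tuple (opp_tuple x) (shift_tuple x y) = y.
      by apply/eq_from_tnth => i; rewrite !tnth_mktuple addrK.
    by split=> y; rewrite /S1/S2/= E.
  apply: (@measurable_preT _ _ _ _ (fun y => (x, y)) S2) => //.
  exact: measurable_pair1.
rewrite integral_sectionsC//.
apply: integral_indic_cst => //.
  move=> z Az; rewrite -[RHS](muS (opp_tuple z))//.
  congr (mu _); apply/seteqP.
  have E x : opp_tuple (shift_tuple (opp_tuple z) x) = shift_tuple (opp_tuple x) z.
    by apply/eq_from_tnth => i; rewrite !tnth_mktuple opprB.
  by split=> x /=; rewrite /S2/= -E QNE// => -[].
move=> z NAz; rewrite (_ : [set _ | _] = set0) ?measure0//.
by apply/seteqP; split => // x [].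
Qed.

Lemma lebesgue_tuple0 (A : set (0.-tuple Rm)) : A [tuple] -> lam 0 A = 1%E.
Proof. by move=> A0; rewrite /= /dirac indicE mem_set. Qed.

Lemma lebesgue_tuple_box n (a b : R) : a <= b ->
  lam n [set x | forall i, a <= tnth x i <= b] = ((b - a) ^+ n)%:E.
Proof.
move=> ab; elim: n => [|n IH].
  by rewrite expr0 lebesgue_tuple0// => -[].
rewrite lebesgue_tupleSE.
transitivity (((b - a) ^+ n)%:E * @lebesgue_measure R `[a, b]%classic)%E; last first.
  rewrite lebesgue_measure_itv/= lte_fin.
  case: ltP => [_|ba]; first by rewrite -EFinB -EFinM exprSr.
  have -> : b = a by apply/le_anti/andP.
  by rewrite subrr mule0 expr0n.
apply: integral_indic_cst => //.
- by rewrite lee_fin exprn_ge0// subr_ge0.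
- move=> x /=; rewrite in_itv/= => abx.
  rewrite -IH; congr (lam n _); apply/seteqP; split => y /=.
    by move=> H i; have := H (lift ord0 i); rewrite tnthS.
  by move=> H i; case: (unliftP ord0 i) => [j ->|->]; rewrite ?tnthS ?tnth0.
- move=> x /=; rewrite in_itv/= => abx; rewrite (_ : [set _ | _] = set0) ?measure0//.
  by apply/seteqP; split => // y /(_ ord0); rewrite tnth0.
Qed.
End Uniqueness.

(** * Euclidean isometries *)

Section Dotprod.
Context {R : realType} {n : nat}.
Implicit Types x y z : 'rV[R]_n.

Lemma dotprodC x y : dotprod x y = dotprod y x.
Proof. by apply: eq_bigr => i _; rewrite mulrC. Qed.

Lemma dotprodDl x y z : dotprod (x + y) z = dotprod x z + dotprod y z.
Proof. by rewrite -big_split/=; apply: eq_bigr => i _; rewrite mxE mulrDl. Qed.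

Lemma dotprodZl (c : R) x z : dotprod (c *: x) z = c * dotprod x z.
Proof. by rewrite /dotprod mulr_sumr; apply: eq_bigr => i _; rewrite mxE mulrA. Qed.

Lemma dotprodNl x z : dotprod (- x) z = - dotprod x z.
Proof. by rewrite -scaleN1r dotprodZl mulN1r. Qed.

Lemma dotprodBl x y z : dotprod (x - y) z = dotprod x z - dotprod y z.
Proof. by rewrite dotprodDl dotprodNl. Qed.

Lemma dotprodDr x y z : dotprod z (x + y) = dotprod z x + dotprod z y.
Proof. by rewrite dotprodC dotprodDl !(dotprodC z). Qed.

Lemma dotprodZr (c : R) x z : dotprod z (c *: x) = c * dotprod z x.
Proof. by rewrite dotprodC dotprodZl dotprodC. Qed.

Lemma dotprodNr x z : dotprod z (- x) = - dotprod z x.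
Proof. by rewrite dotprodC dotprodNl dotprodC. Qed.

Lemma dotprodBr x y z : dotprod z (x - y) = dotprod z x - dotprod z y.
Proof. by rewrite dotprodDr dotprodNr. Qed.

Lemma dotprod0l z : dotprod 0 z = 0.
Proof. by rewrite /dotprod big1// => i _; rewrite mxE mul0r. Qed.

Lemma dotprod_ge0 x : 0 <= dotprod x x.
Proof. by apply: sumr_ge0 => i _; rewrite -expr2 sqr_ge0. Qed.

Lemma dotprod_eq0 x : dotprod x x = 0 -> x = 0.
Proof.
move=> /eqP; rewrite psumr_eq0 => [/allP x0|i _]; last by rewrite -expr2 sqr_ge0.
apply/rowP => i; rewrite mxE.
have := x0 i; rewrite mem_index_enum => /(_ isT) /=.
by rewrite mulf_eq0 orbb => /eqP.
Qed.

Lemma dotprod_sumr (I : finType) (F : I -> 'rV[R]_n) x :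
  dotprod x (\sum_i F i) = \sum_i dotprod x (F i).
Proof.
apply: (big_morph (dotprod x)) => [y z|]; first exact: dotprodDr.
by rewrite dotprodC dotprod0l.
Qed.

Lemma dotprod_delta x i : dotprod x (delta_mx 0 i) = x 0 i.
Proof.
rewrite /dotprod (bigD1 i)//= mxE !eqxx mulr1 big1 ?addr0// => j ji.
by rewrite mxE (negbTE ji) andbF mulr0.
Qed.

Lemma dotprod_polar x y :
  dotprod x y = (dotprod x x + dotprod y y - dotprod (x - y) (x - y)) / 2.
Proof. by rewrite dotprodBl !dotprodBr (dotprodC y x); field. Qed.

Lemma eucl_norm_sqr x : eucl_norm x ^+ 2 = dotprod x x.
Proof. by rewrite sqr_sqrtr// dotprod_ge0. Qed.

End Dotprod.

Section Isometries.
Context {R : realType}.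
Local Notation Rm := (measurableTypeR R).
Local Notation lam := (@lebesgue_tuple R).

Lemma isometric_dotprod m n (f : 'rV[R]_m -> 'rV[R]_n) : isometric f ->
  forall x y, dotprod (f x - f y) (f x - f y) = dotprod (x - y) (x - y).
Proof. by move=> fi x y; rewrite -eucl_norm_sqr fi eucl_norm_sqr. Qed.

(** By polarization [x |-> f x - f 0] preserves dot products.  The squared
    distance between its values and those of the linear map that agrees with it on
    the canonical basis then expands to 0. *)
Lemma isometric_affine m n (f : 'rV[R]_m -> 'rV[R]_n) : isometric f ->
  exists M : 'M[R]_(m, n), (forall x, f x = f 0 + x *m M) /\
    forall x y, dotprod (x *m M) (y *m M) = dotprod x y.
Proof.
move=> /isometric_dotprod fi.
have [g gdef] : exists g : 'rV[R]_m -> 'rV[R]_n, forall x, g x = f x - f 0.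
  by exists (fun x => f x - f 0).
have gE x y : dotprod (g x) (g y) = dotprod x y.
  rewrite (dotprod_polar (g x)) (dotprod_polar x) !gdef !fi.
  have -> : f x - f 0 - (f y - f 0) = f x - f y.
    by rewrite opprB addrA subrK.
  by rewrite fi !subr0.
pose M : 'M[R]_(m, n) := \matrix_i g (delta_mx 0 i).
have ME x : x *m M = \sum_i x 0 i *: g (delta_mx 0 i).
  by rewrite mulmx_sum_row; apply: eq_bigr => i _; rewrite rowK.
have gM x y : dotprod (g x) (y *m M) = dotprod x y.
  rewrite ME dotprod_sumr; apply: eq_bigr => i _.
  by rewrite dotprodZr gE dotprod_delta mulrC.
have MM x y : dotprod (x *m M) (y *m M) = dotprod x y.
  rewrite {1}ME (dotprodC _ (y *m M)) dotprod_sumr; apply: eq_bigr => i _.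
  by rewrite dotprodZr dotprodC gM dotprodC dotprod_delta.
exists M; split => // x; apply/eqP; rewrite addrC -subr_eq -subr_eq0; apply/eqP.
apply: dotprod_eq0; rewrite -gdef dotprodBl !dotprodBr gE gM.
by rewrite (dotprodC _ (g x)) gM MM !subrr.
Qed.

Definition rV_of n (s : n.-tuple Rm) : 'rV[R]_n := \row_i tnth s i.
Definition tuple_of n (x : 'rV[R]_n) : n.-tuple Rm := [tuple x 0 i | i < n].

Lemma rV_ofK n : cancel (@rV_of n) (@tuple_of n).
Proof. by move=> s; apply/eq_from_tnth => i; rewrite tnth_mktuple mxE. Qed.

Lemma tuple_ofK n : cancel (@tuple_of n) (@rV_of n).
Proof. by move=> s; apply/rowP => i; rewrite mxE tnth_mktuple. Qed.

Lemma rV_of_shift n (w x : n.-tuple Rm) : rV_of (shift_tuple w x) = rV_of x + rV_of w.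
Proof. by apply/rowP => i; rewrite !mxE tnth_mktuple. Qed.

Lemma rV_of_opp n (x : n.-tuple Rm) : rV_of (opp_tuple x) = - rV_of x.
Proof. by apply/rowP => i; rewrite !mxE tnth_mktuple. Qed.

Lemma measurable_rV_of n (i : 'I_n) : measurable_fun setT (fun s => rV_of s 0 i).
Proof.
have -> : (fun s => rV_of s 0 i) = fun s : n.-tuple Rm => tnth s i.
  by apply/funext => s; rewrite mxE.
exact: measurable_coord.
Qed.

Lemma measurable_isometric m n (f : 'rV[R]_m -> 'rV[R]_n) (i : 'I_n) :
  isometric f -> measurable_fun setT (fun s => f (rV_of s) 0 i).
Proof.
move=> /isometric_affine[M [fE _]].
have -> : (fun s => f (rV_of s) 0 i) =
    (fun s => f 0 0 i + \sum_j rV_of s 0 j * M j i).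
  by apply/funext => s; rewrite fE !mxE.
apply: measurable_funD => //; apply: measurable_sum => j.
by apply: measurable_funM => //; exact: measurable_rV_of.
Qed.

Lemma measurable_box n (a b : R) :
  measurable [set s : n.-tuple Rm | forall i, a <= tnth s i <= b].
Proof.
rewrite [X in measurable X](_ : _ =
    \bigcap_(i in setT) [set s : n.-tuple Rm | a <= tnth s i <= b]); last first.
  apply/seteqP; split => s /=; first by move=> H i _; exact: H.
  by move=> H i; exact: H.
apply: fin_bigcap_measurable => [|i _]; first exact: finite_finset.
have := measurable_preT (@measurable_coord R n i) (measurable_itv `[a, b]).
by congr (measurable _); apply/seteqP; split => s; rewrite /= in_itv.
Qed.

Definition ball_tuple n (c : 'rV[R]_n) (r : R) : set (n.-tuple Rm) :=
  [set s | dotprod (rV_of s - c) (rV_of s - c) <= r ^+ 2].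

Lemma measurable_ball_tuple n (c : 'rV[R]_n) r : measurable (ball_tuple c r).
Proof.
rewrite (_ : ball_tuple c r =
  (fun s => dotprod (rV_of s - c) (rV_of s - c)) @^-1` `]-oo, r ^+ 2]%classic).
  apply: measurable_preT => //; apply: measurable_sum => j.
  rewrite [X in measurable_fun _ X](_ : _ =
    (fun s => (rV_of s 0 j - c 0 j) * (rV_of s 0 j - c 0 j))); last first.
    by apply/funext => s; rewrite !mxE.
  by apply: measurable_funM; apply: measurable_funB => //; exact: measurable_rV_of.
by apply/seteqP; split => s; rewrite /= in_itv.
Qed.

Lemma lebesgue_ball_lty n r : 0 <= r -> (lam n (ball_tuple 0 r) < +oo)%E.
Proof.
move=> r0.
have rr : - r <= r by rewrite (le_trans _ r0)// oppr_le0.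
apply: (@le_lt_trans _ _ (lam n [set x | forall i, - r <= tnth x i <= r])).
  apply: le_measure; rewrite ?inE//; first exact: measurable_ball_tuple.
    exact: measurable_box.
  move=> s; rewrite /ball_tuple/= subr0 => H i.
  rewrite -ler_norml -ler_sqr ?nnegrE// real_normK ?num_real//.
  apply: le_trans H; rewrite /dotprod (bigD1 i)//= !mxE -expr2 lerDl.
  by apply: sumr_ge0 => j _; rewrite -expr2 sqr_ge0.
by rewrite lebesgue_tuple_box// ltry.
Qed.

Lemma lebesgue_ball_gt0 n : (0 < lam n (ball_tuple 0 1))%E.
Proof.
(* the cube of half-side [1 / (n + 1)] fits in the unit ball *)
pose e : R := n.+1%:R^-1.
have e0 : 0 < e by rewrite invr_gt0.
have ee : - e <= e by rewrite (le_trans _ (ltW e0))// oppr_le0 ltW.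
apply: (@lt_le_trans _ _ (lam n [set x | forall i, - e <= tnth x i <= e])).
  by rewrite lebesgue_tuple_box// lte_fin exprn_gt0// opprK addr_gt0.
apply: le_measure; rewrite ?inE//; last 2 first.
- exact: measurable_ball_tuple.
- move=> s /= H; rewrite /ball_tuple/= subr0 expr1n.
  apply: (@le_trans _ _ (\sum_(i < n) e)).
    apply: ler_sum => i _; rewrite mxE -expr2.
    rewrite -real_normK ?num_real//.
    have : `|tnth s i| <= e by rewrite ler_norml.
    move=> se; rewrite (le_trans (ler_piMr _ _))//.
    by rewrite (le_trans se)// invf_le1// ler1n.
  by rewrite sumr_const card_ord -mulr_natl ler_pdivrMr// mul1r ler_nat.
exact: measurable_box.
Qed.
End Isometries.

Section SigmaFinitePack.
Context d (T : measurableType d) (R : realType).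
Variables (mu : {measure set T -> \bar R}) (musf : sigma_finite setT mu).

(** An alias of [mu] that carries the proof of sigma-finiteness, so that the
    corresponding structure can be inferred from it. *)
Definition sigma_finite_pack of sigma_finite setT mu : set T -> \bar R := mu.

Local Notation nu := (sigma_finite_pack musf).

Let nu0 : nu set0 = 0%E. Proof. exact: measure0. Qed.
Let nu_ge0 A : (0 <= nu A)%E. Proof. exact: measure_ge0. Qed.
Let nu_sigma_additive : semi_sigma_additive nu.
Proof. exact: measure_semi_sigma_additive. Qed.

HB.instance Definition _ := isMeasure.Build _ _ _ nu nu0 nu_ge0 nu_sigma_additive.
HB.instance Definition _ := Measure_isSigmaFinite.Build _ _ _ nu musf.

End SigmaFinitePack.

Section IsometryInvariance.
Context {R : realType}.
Local Notation Rm := (measurableTypeR R).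
Local Notation lam := (@lebesgue_tuple R).

Lemma ball_tuple_cover n (c : 'rV[R]_n) :
  setT = \bigcup_k ball_tuple c k%:R.
Proof.
apply/esym/seteqP; split => // s _.
exists (Num.bound (dotprod (rV_of s - c) (rV_of s - c))) => //.
rewrite /ball_tuple/=; set k := Num.bound _.
apply: (@le_trans _ _ k%:R); first by apply/ltW/archi_boundP/dotprod_ge0.
by rewrite -natrX ler_nat; case: k => // k; rewrite expnS leq_pmulr.
Qed.

(** The pullback of Lebesgue measure by a surjective isometry is translation
    invariant, hence proportional to it.  The ratio is 1 because the preimage of
    a ball is a ball with the same radius. *)
Lemma isometric_lebesgue n (F : 'rV[R]_n -> 'rV[R]_n) (A : set (n.-tuple Rm)) :
  isometric F -> (forall y, exists x, F x = y) -> measurable A ->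
  lam n [set s | A (tuple_of (F (rV_of s)))] = lam n A.
Proof.
move=> Fi Fsurj mA.
pose G (s : n.-tuple Rm) : n.-tuple Rm := tuple_of (F (rV_of s)).
have mG : measurable_fun setT G.
  apply: (measurable_tuple_of (f := fun s i => F (rV_of s) 0 i)) => i.
  exact: measurable_isometric.
have [mu muE] : exists mu : {measure set (n.-tuple Rm) -> \bar R},
    forall B, mu B = lam n (G @^-1` B).
  by exists (measure_function_pushforward__canonical__measure_function_Measure (lam n) mG).
have ballE r : G @^-1` (ball_tuple (F 0) r) = ball_tuple 0 r.
  apply/seteqP; split => s; rewrite /ball_tuple/= /G tuple_ofK;
    by rewrite (isometric_dotprod Fi).
have musf : sigma_finite setT mu.
  exists (fun k => ball_tuple (F 0) k%:R); first exact: ball_tuple_cover.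
  move=> k; split; first exact: measurable_ball_tuple.
  by rewrite muE ballE lebesgue_ball_lty.
pose mu' : {sigma_finite_measure set (n.-tuple Rm) -> \bar R} :=
  sigma_finite_pack musf.
have muS w B : measurable B -> mu' (shift_tuple w @^-1` B) = mu' B.
  move=> mB.
  have [z Fz] := Fsurj (F 0 + rV_of w).
  have [M [FE _]] := isometric_affine Fi.
  rewrite [LHS]muE [RHS]muE -[RHS](lebesgue_tuple_shift (tuple_of z)).
    congr (lam n _); apply/seteqP.
    have E s : G (shift_tuple (tuple_of z) s) = shift_tuple w (G s).
      rewrite /G -[RHS]rV_ofK; congr tuple_of.
      rewrite !rV_of_shift !tuple_ofK.
      have -> : rV_of w = z *m M.
        by apply: (addrI (F 0)); rewrite -Fz FE.
      by rewrite FE mulmxDl addrA -FE.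
    by split=> s /=; rewrite E.
  exact: measurable_preT.
have Q0 : (mu' (ball_tuple 0 1) = lam n (ball_tuple 0 1))%E.
  rewrite -(muS (tuple_of (- F 0))); last exact: measurable_ball_tuple.
  rewrite [LHS]muE -[in RHS](ballE 1); congr (lam n (G @^-1` _)).
  by apply/seteqP; split => s; rewrite /ball_tuple/= rV_of_shift tuple_ofK subr0.
have := translation_invariant_unique muS mA (@measurable_ball_tuple _ n 0 1).
rewrite Q0 [mu' A]muE => /(_ _).
have QN x : ball_tuple 0 1 x -> @ball_tuple R n 0 1 (opp_tuple x).
  by rewrite /ball_tuple/= rV_of_opp !subr0 dotprodNl dotprodNr opprK.
move=> /(_ QN) /eqP; rewrite muleC.
have Qfin : (lam n (ball_tuple 0 1) \is a fin_num)%E.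
  by rewrite ge0_fin_numE// lebesgue_ball_lty.
have Q0' := @lebesgue_ball_gt0 R n.
move: Qfin Q0'; case: (lam n (ball_tuple 0 1)) => // q _ q0.
move: q0; rewrite -[0%E]/(0%:E) lte_fin => q0.
move=> /eqP /(congr1 (fun x => q^-1%:E * x)%E).
by rewrite !muleA -EFinM mulVf ?gt_eqF// !mul1e.
Qed.
End IsometryInvariance.

(** * Sections of the cube by hyperplanes *)

Section HyperplaneSection.
Context {R : realType}.
Local Notation Rm := (measurableTypeR R).
Local Notation lam := (@lebesgue_tuple R).

Lemma lebesgue_measure_affine (c h : R) (A : set R) : c != 0 -> measurable A ->
  (`|c|%:E * lebesgue_measure [set x : R | A (c * x + h)%R])%E
  = lebesgue_measure A.
Proof.
move=> c0 mA.
have mh : measurable [set x : Rm | A (x + h)].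
  have mf : measurable_fun setT (fun x : Rm => x + h : Rm) by apply: measurable_funD.
  exact: measurable_preT mf mA.
have [cp|cn] := ltP 0 c.
  by rewrite gtr0_norm// (lebesgue_measure_scale cp mh) lebesgue_measure_shift.
have cp : 0 < - c by rewrite oppr_gt0 lt_neqAle c0.
rewrite ltr0_norm -?oppr_gt0//.
have mN : measurable [set x : Rm | A (- x + h)].
  exact: measurable_preT (@oppr_measurable R setT) mh.
rewrite -[RHS](lebesgue_measure_shift h)// -[RHS]/(lebesgue_measure [set x : Rm | A (x + h)]) -(lebesgue_measureN mh).
rewrite -[RHS](lebesgue_measure_scale cp)//.
by congr (_ * lebesgue_measure _)%E; apply/seteqP; split=> x /=; rewrite mulNr opprK.
Qed.

Lemma pair2_measurable_cons n (y : n.-tuple Rm) :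
  measurable_fun setT (fun x : Rm => cons_pair (x, y)).
Proof. exact: (@measurable_cons _ _ _ Rm id n (fun=> y)). Qed.

Lemma measurable_fun_ysection_set d1 d2 (T1 : measurableType d1)
    (T2 : measurableType d2) (mu : {sigma_finite_measure set T1 -> \bar R})
    (S : set (T1 * T2)) : measurable S ->
  measurable_fun setT (fun y => mu [set x | S (x, y)]).
Proof.
move=> mS; apply: eq_measurable_fun (measurable_fun_ysection mu mS) => y _ /=.
by congr (mu _); apply/seteqP; split=> x; rewrite /ysection/= inE.
Qed.

Lemma rV_of_cons0 n (x : R) (y : n.-tuple Rm) : rV_of (cons_pair (x : Rm, y)) 0 ord0 = x.
Proof. by rewrite mxE tnth0. Qed.

Lemma rV_of_consS n (x : R) (y : n.-tuple Rm) i :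
  rV_of (cons_pair (x : Rm, y)) 0 (lift ord0 i) = tnth y i.
Proof. by rewrite mxE tnthS. Qed.

Variables (m : nat) (a : 'rV[R]_m.+1) (b : R).
Hypothesis a1 : forall i, a 0 i ^+ 2 = 1.
Let rN : R := Num.sqrt m.+1%:R.
Let u := rN^-1 *: a.

Let rN_gt0 : 0 < rN. Proof. by rewrite sqrtr_gt0 ltr0n. Qed.
Let rN_neq0 : rN != 0. Proof. exact: lt0r_neq0. Qed.
Let rN2 : rN ^+ 2 = m.+1%:R. Proof. by rewrite sqr_sqrtr. Qed.

Lemma dotprod_signs : dotprod a a = m.+1%:R.
Proof.
rewrite /dotprod (eq_bigr (fun=> 1)) => [|i _]; last by rewrite -expr2 a1.
by rewrite sumr_const card_ord.
Qed.

Let ua : dotprod u a = rN.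
Proof. by rewrite dotprodZl dotprod_signs -rN2 expr2 mulKf. Qed.
Let uu : dotprod u u = 1.
Proof. by rewrite dotprodZr ua mulVf. Qed.

(** Signed distance to the hyperplane and orthogonal projection onto it, for
    [a] with entries [1] and [-1]. *)
Definition slab_coord (x : 'rV[R]_m.+1) : R := (dotprod x a - b) / rN.
Definition slab_proj (x : 'rV[R]_m.+1) := x - slab_coord x *: u.

Definition slab : set (m.+1.-tuple Rm) :=
  [set s | 0 <= slab_coord (rV_of s) <= 1 /\ @cube R m.+1 (slab_proj (rV_of s))].

(** The hyperplane is seen as a graph over the last [m] coordinates. *)
Definition graph_point (y : m.-tuple Rm) : 'rV[R]_m.+1 :=
  rV_of (cons_pair (a 0 ord0 * (b - \sum_i a 0 (lift ord0 i) * tnth y i) : Rm, y)).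

(** The point with last coordinates [y] at signed distance [s]. *)
Let graph_cons (s : R) (y : m.-tuple Rm) : m.+1.-tuple Rm :=
  cons_pair (a 0 ord0 * rN * s +
    a 0 ord0 * (b - \sum_i a 0 (lift ord0 i) * tnth y i) : Rm, y).

Let slab_coord_graph s y : slab_coord (rV_of (graph_cons s y)) = s.
Proof.
rewrite /slab_coord /dotprod big_ord_recl /graph_cons rV_of_cons0.
set t := (X in b - X); rewrite (_ : \sum_(i < m) _ = t); last first.
  by apply: eq_bigr => i _; rewrite rV_of_consS mulrC.
have -> : (a 0 ord0 * rN * s + a 0 ord0 * (b - t)) * a 0 ord0 + t - b =
   a 0 ord0 ^+ 2 * (rN * s + (b - t)) + t - b by ring.
by rewrite a1; field.
Qed.

(** Projecting shifts the last coordinates by [s] times those of the unit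
    normal. *)
Let slab_proj_graph s y : slab_proj (rV_of (graph_cons s y)) =
  graph_point (shift_tuple [tuple - s * u 0 (lift ord0 i) : R | i < m] y).
Proof.
rewrite /slab_proj slab_coord_graph /graph_point.
apply/rowP => i; rewrite [LHS]mxE [in LHS]mxE [X in _ + X = _]mxE.
case: (unliftP ord0 i) => [j ->|->].
  by rewrite tnthS rV_of_consS !tnth_mktuple mxE mulNr.
rewrite tnth0 rV_of_cons0 mxE.
have -> : \sum_(i0 < m) a 0 (lift ord0 i0) *
    tnth (shift_tuple [tuple - s * u 0 (lift ord0 i1) : R | i1 < m] y) i0 =
  \sum_(i < m) a 0 (lift ord0 i) * tnth y i - s * (m%:R / rN).
  transitivity (\sum_(i < m) (a 0 (lift ord0 i) * tnth y i - s * rN^-1)).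
    apply: eq_bigr => k _; rewrite !tnth_mktuple mxE.
    have -> : a 0 (lift ord0 k) * (tnth y k + - s * (rN^-1 * a 0 (lift ord0 k))) =
      a 0 (lift ord0 k) * tnth y k - s * (rN^-1 * a 0 (lift ord0 k) ^+ 2) by ring.
    by rewrite a1 mulr1.
  rewrite sumrB sumr_const card_ord -[_ *+ m]mulr_natl; congr (_ - _); ring.
have -> : m%:R = rN ^+ 2 - 1 by rewrite rN2 -natr1 addrK.
by rewrite /= /u mxE; field.
Qed.

Lemma measurable_slab : measurable slab.
Proof.
have mc : measurable_fun setT (fun s : m.+1.-tuple Rm => slab_coord (rV_of s)).
  apply: measurable_funM => //; apply: measurable_funB => //.
  apply: measurable_sum => i; apply: measurable_funM => //.
  exact: measurable_rV_of.
apply: measurableI.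
  have := measurable_preT mc (measurable_itv `[0, 1]).
  by congr (measurable _); apply/seteqP; split => s; rewrite /= in_itv.
have mp i : measurable_fun setT (fun s : m.+1.-tuple Rm => slab_proj (rV_of s) 0 i).
  have -> : (fun s : m.+1.-tuple Rm => slab_proj (rV_of s) 0 i) =
     (fun s => rV_of s 0 i - slab_coord (rV_of s) * u 0 i).
    by apply/funext => s; rewrite /slab_proj mxE [X in _ + X = _]mxE [X in _ - X = _]mxE.
  apply: measurable_funB; first exact: measurable_rV_of.
  exact: measurable_funM.
have := measurable_preT (@measurable_tuple_of R _ _ m.+1 (fun s i => slab_proj (rV_of s) 0 i) mp) (@measurable_box R m.+1 0 1).
congr (measurable _); apply/seteqP; split => s /= H i; have := H i;
  by rewrite tnth_mktuple.
Qed.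

Lemma measurable_graph_cube :
  measurable [set y : m.-tuple Rm | @cube R m.+1 (graph_point y)].
Proof.
have mg : measurable_fun setT (fun y : m.-tuple Rm =>
   cons_pair (a 0 ord0 * (b - \sum_i a 0 (lift ord0 i) * tnth y i) : Rm, y)).
  apply: (@measurable_cons _ _ _ Rm (fun y : m.-tuple Rm =>
    a 0 ord0 * (b - \sum_i a 0 (lift ord0 i) * tnth y i) : Rm) m id) => //.
  apply: measurable_funM => //; apply: measurable_funB => //.
  apply: measurable_sum => i; apply: measurable_funM => //.
  exact: measurable_coord.
have := measurable_preT mg (@measurable_box R m.+1 0 1).
congr (measurable _); apply/seteqP; split => s /= H i; have := H i;
  by rewrite mxE.
Qed.

(** On a line parallel to the first axis the signed distance grows at rate
    [1 / sqrt (m + 1)], whence the factor.  At a given signed distance, the points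
    of the slab form a translate of the section read on the graph. *)
Lemma lebesgue_slab :
  lam m.+1 slab = (rN%:E * lam m [set y | @cube R m.+1 (graph_point y)])%E.
Proof.
rewrite lebesgue_tuple_fubini; last exact: measurable_slab.
have c0 : a 0 ord0 * rN != 0.
  rewrite mulf_neq0//; apply/eqP => a0; have := a1 ord0.
  by rewrite a0 expr0n => /eqP; rewrite eq_sym oner_eq0.
have c1 : `|a 0 ord0 * rN| = rN.
  rewrite normrM (gtr0_norm rN_gt0); have := a1 ord0.
  by move=> /(congr1 Num.sqrt); rewrite sqrtr_sqr sqrtr1 => ->; rewrite mul1r.
pose S : set (Rm * m.-tuple Rm) := [set p | slab (graph_cons p.1 p.2)].
have mgr : measurable_fun setT (fun p : Rm * m.-tuple Rm => graph_cons p.1 p.2).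
  apply: (@measurable_cons _ _ _ Rm (fun p : Rm * m.-tuple Rm =>
    a 0 ord0 * rN * p.1 +
    a 0 ord0 * (b - \sum_i a 0 (lift ord0 i) * tnth p.2 i) : Rm) m snd) => //.
  apply: measurable_funD; first exact: measurable_funM.
  apply: measurable_funM => //; apply: measurable_funB => //.
  apply: measurable_sum => i; apply: measurable_funM => //.
  exact: (measurableT_comp (@measurable_coord _ _ i)).
have mS : measurable S by exact: measurable_preT mgr measurable_slab.
transitivity (rN%:E * \int[lam m]_y lebesgue_measure [set s | S (s, y)])%E.
  rewrite -ge0_integralZl//; last 2 first.
  - exact: measurable_fun_ysection_set mS.
  - rewrite lee_fin; exact: ltW.
  apply: eq_integral => y _.
  rewrite -c1 -(lebesgue_measure_affine (a 0 ord0 * (b - \sum_i a 0 (lift ord0 i) * tnth y i)) c0)//.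
  exact: (measurable_preT (pair2_measurable_cons y) measurable_slab).
rewrite -integral_sectionsC//; congr (_ * _)%E.
rewrite -[RHS]mule1.
transitivity (lam m [set y | @cube R m.+1 (graph_point y)] * @lebesgue_measure R `[0%R, 1%R]%classic)%E; last first.
  by rewrite lebesgue_measure_itv/= lte_fin ltr01 -EFinB subr0.
apply: integral_indic_cst => //.
  move=> s; rewrite /= in_itv/= => s01.
  rewrite -[RHS](lebesgue_tuple_shift [tuple - s * u 0 (lift ord0 i) : R | i < m]).
    congr (lam m _); apply/seteqP.
    split=> y; rewrite /S /slab/= slab_coord_graph slab_proj_graph; by [move=> []|].
  exact: measurable_graph_cube.
move=> s; rewrite /= in_itv/= => s01; rewrite (_ : [set _ | _] = set0) ?measure0//.
by apply/seteqP; split => // y; rewrite /S/slab/= slab_coord_graph => -[].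
Qed.
End HyperplaneSection.

Section HyperplaneParam.
Context {R : realType}.
Local Notation Rm := (measurableTypeR R).
Local Notation lam := (@lebesgue_tuple R).
Variables (m : nat) (a : 'rV[R]_m.+1) (b : R).
Hypothesis a1 : forall i, a 0 i ^+ 2 = 1.
Let rN : R := Num.sqrt m.+1%:R.
Let u := rN^-1 *: a.

Let rN_gt0 : 0 < rN. Proof. by rewrite sqrtr_gt0 ltr0n. Qed.
Let rN_neq0 : rN != 0. Proof. exact: lt0r_neq0. Qed.
Let rN2 : rN ^+ 2 = m.+1%:R. Proof. by rewrite sqr_sqrtr. Qed.
Let ua : dotprod u a = rN.
Proof. by rewrite dotprodZl (dotprod_signs a1) -rN2 expr2 mulKf. Qed.
Let uu : dotprod u u = 1.
Proof. by rewrite dotprodZr ua mulVf. Qed.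

Variable f : 'rV[R]_m -> 'rV[R]_m.+1.
Hypotheses (fi : isometric f) (fH : range f = [set x | dotprod x a = b]).

Let behead_rV (x : 'rV[R]_m.+1) : 'rV[R]_m := \row_i x 0 (lift ord0 i).
Let F (x : 'rV[R]_m.+1) := f (behead_rV x) + x 0 0 *: u.

Let fa y : dotprod (f y) a = b.
Proof. by have : range f (f y) by []; rewrite fH. Qed.

Let fu y z : dotprod (f y - f z) u = 0.
Proof. by rewrite dotprodZr dotprodBl !fa subrr mulr0. Qed.

Let F_isometric : isometric F.
Proof.
move=> x y; congr Num.sqrt; rewrite /F.
have -> : f (behead_rV x) + x 0 0 *: u - (f (behead_rV y) + y 0 0 *: u) =
    (f (behead_rV x) - f (behead_rV y)) + (x 0 0 - y 0 0) *: u.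
  by rewrite scalerBl opprD addrACA.
have sqrD (p v : 'rV[R]_m.+1) (c : R) : dotprod p v = 0 -> dotprod v v = 1 ->
    dotprod (p + c *: v) (p + c *: v) = dotprod p p + c * c.
  move=> pv vv; rewrite dotprodDl !dotprodDr !dotprodZl !dotprodZr (dotprodC v) pv vv.
  by rewrite !mulr0 mulr1 addr0 add0r.
rewrite (sqrD _ _ _ (fu _ _) uu).
rewrite (isometric_dotprod fi) [RHS]/dotprod big_ord_recl !mxE.
rewrite [LHS]addrC; congr (_ + _).
by apply: eq_bigr => i _; rewrite !mxE.
Qed.

Let F_surj y : exists x, F x = y.
Proof.
pose s := (dotprod y a - b) / rN.
have : range f (y - s *: u).
  by rewrite fH/= dotprodBl dotprodZl ua divfK// subKr.
move=> [z _ fz].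
exists (rV_of (cons_pair (s : Rm, tuple_of z))).
rewrite /F (_ : behead_rV _ = z).
  by rewrite rV_of_cons0 fz subrK.
by apply/rowP => i; rewrite mxE rV_of_consS tnth_mktuple.
Qed.

(** The isometry [F] pulls the slab back to the product of the unit interval and
    the section read through [f]. *)
Lemma isometric_hyperplane_cube :
  lam m [set y | @cube R m.+1 (f (rV_of y))] =
  (rN%:E * lam m [set y | @cube R m.+1 (graph_point a b y)])%E.
Proof.
rewrite -(lebesgue_slab b a1).
rewrite -(isometric_lebesgue F_isometric F_surj (measurable_slab a b)).
rewrite lebesgue_tupleSE -[LHS]mule1.
have -> : 1%E = @lebesgue_measure R `[0%R, 1%R]%classic.
  by rewrite lebesgue_measure_itv/= lte_fin ltr01 -EFinB subr0.
have cE s (y : m.-tuple Rm) : slab_coord a b (F (rV_of (cons_pair (s : Rm, y)))) = s.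
  rewrite /slab_coord /F dotprodDl fa dotprodZl ua rV_of_cons0.
  by rewrite [b + _]addrC addrK mulfK.
have pE s (y : m.-tuple Rm) :
    slab_proj a b (F (rV_of (cons_pair (s : Rm, y)))) = f (rV_of y).
  rewrite /slab_proj cE /F rV_of_cons0 addrK; congr f.
  by apply/rowP => i; rewrite [LHS]mxE rV_of_consS mxE.
apply/esym/integral_indic_cst => //.
  move=> s; rewrite /= in_itv/= => s01; congr (lam m _); apply/seteqP.
  split=> y; rewrite /slab/= tuple_ofK cE pE; by [move=> []|].
move=> s; rewrite /= in_itv/= => s01; rewrite (_ : [set _ | _] = set0) ?measure0//.
by apply/seteqP; split => // y; rewrite /slab/= tuple_ofK cE => -[].
Qed.

End HyperplaneParam.

Section Householder.
Context {R : realType} {n : nat}.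
Implicit Types w x y : 'rV[R]_n.

Definition householder w x : 'rV[R]_n :=
  x - (2 / dotprod w w * dotprod x w) *: w.

Lemma dotprod_householderC w x y :
  dotprod (householder w x) y = dotprod x (householder w y).
Proof.
by rewrite /householder dotprodBl dotprodBr dotprodZl dotprodZr (dotprodC y w); ring.
Qed.

Lemma householderK w : involutive (householder w).
Proof.
move=> x; rewrite {1}/householder {2}/householder dotprodBl dotprodZl.
rewrite /householder -addrA -opprD -scalerDl.
have [w0|w0] := eqVneq (dotprod w w) 0.
  by rewrite w0 invr0 !(mulr0, mul0r) addr0 scale0r subr0.
set c := (X in X *: w); have -> : c = 0 by rewrite /c; field.
by rewrite scale0r subr0.
Qed.

Lemma householderB w x y : householder w (x - y) = householder w x - householder w y.
Proof.
by rewrite /householder dotprodBl; apply/rowP => i; rewrite !mxE; ring.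
Qed.

Lemma householder_isometric w : isometric (householder w).
Proof.
by move=> x y; rewrite /eucl_norm -householderB dotprod_householderC householderK.
Qed.

(** When [x = y] the convention [2 / 0 = 0] makes the reflection the identity. *)
Lemma householder_swap x y : dotprod x x = dotprod y y ->
  householder (x - y) x = y.
Proof.
move=> xy; rewrite /householder.
have [w0|w0] := eqVneq (dotprod (x - y) (x - y)) 0.
  by rewrite (dotprod_eq0 w0) scaler0 subr0; apply/subr0_eq/dotprod_eq0.
have -> : 2 / dotprod (x - y) (x - y) * dotprod x (x - y) = 1; last first.
  by rewrite scale1r subKr.
have E : dotprod (x - y) (x - y) = 2 * dotprod x (x - y).
  by rewrite dotprodBl !dotprodBr -xy (dotprodC y x); ring.
by move: w0; rewrite E mulf_eq0 negb_or => /andP[_ w0]; field.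
Qed.

End Householder.

Section Volume.
Context {R : realType}.
Local Notation Rm := (measurableTypeR R).
Local Notation lam := (@lebesgue_tuple R).

(** The infimum is attained at the foot of the perpendicular. *)
Lemma eucl_dist_hyperplane n (a c : 'rV[R]_n) (b : R) : 0 < dotprod a a ->
  eucl_dist c [set x | dotprod x a = b] = `|dotprod c a - b| / Num.sqrt (dotprod a a).
Proof.
move=> a0; set N := dotprod a a.
have sN : 0 < Num.sqrt N by rewrite sqrtr_gt0.
set y0 := c - ((dotprod c a - b) / N) *: a.
have y0H : dotprod y0 a = b by rewrite dotprodBl dotprodZl divfK ?gt_eqF// subKr.
have y0E : eucl_norm (c - y0) = `|dotprod c a - b| / Num.sqrt N.
  rewrite subKr /eucl_norm dotprodZl dotprodZr -/N.
  rewrite (_ : _ * _ = ((dotprod c a - b) / Num.sqrt N) ^+ 2); last first.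
    by rewrite expr_div_n sqr_sqrtr ?ltW//; field; exact: lt0r_neq0.
  by rewrite sqrtr_sqr normrM normfV (gtr0_norm sN).
have lb y : dotprod y a = b -> `|dotprod c a - b| / Num.sqrt N <= eucl_norm (c - y).
  move=> yH; rewrite -y0E ler_sqrt ?dotprod_ge0// -subr_ge0.
  have -> : c - y = (c - y0) + (y0 - y) by rewrite addrA subrK.
  have o : dotprod (c - y0) (y0 - y) = 0.
    by rewrite subKr dotprodZl dotprodBr !(dotprodC a) y0H yH subrr mulr0.
  move: (c - y0) (y0 - y) o => p q pq.
  by rewrite dotprodDl !dotprodDr (dotprodC q p) pq add0r addr0 addrAC subrr add0r dotprod_ge0.
apply/le_anti/andP; split.
  rewrite -y0E; apply: ge_inf; last by exists y0.
  by exists 0 => _ [y _ <-]; exact: sqrtr_ge0.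
apply: lb_le_inf; first by exists (eucl_norm (c - y0)), y0.
by move=> _ [y yH <-]; exact: lb.
Qed.

(** The section of the cube in graph coordinates: the inequality bounds the
    first coordinate, and [s] is the offset of the hyperplane from the center. *)
Definition cube_slice m (a : 'I_m -> R) (s : R) : set (m.-tuple Rm) :=
  [set y | (forall i, 0 <= tnth y i <= 1) /\
           `|s - \sum_i a i * (tnth y i - 2^-1)| <= 2^-1].

Lemma measurable_cube_slice m (a : 'I_m -> R) s : measurable (cube_slice a s).
Proof.
apply: measurableI; first exact: measurable_box.
have mf : measurable_fun setT (fun y : m.-tuple Rm =>
    s - \sum_i a i * (tnth y i - 2^-1)).
  apply: measurable_funB => //; apply: measurable_sum => i.
  apply: measurable_funM => //; apply: measurable_funB => //.
  exact: measurable_coord.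
have := measurable_preT mf (measurable_itv `[- 2^-1, 2^-1]).
by congr (measurable _); apply/seteqP; split => y; rewrite /= in_itv/= ler_norml.
Qed.

Lemma cube_slice_le1 m (a : 'I_m -> R) s : (lam m (cube_slice a s) <= 1)%E.
Proof.
have := @lebesgue_tuple_box R m 0 1 ler01; rewrite subr0 expr1n => <-.
apply: le_measure; rewrite ?inE//; last by move=> y [].
  exact: measurable_cube_slice.
exact: measurable_box.
Qed.

Lemma cube_slice_fin m (a : 'I_m -> R) s : lam m (cube_slice a s) \is a fin_num.
Proof.
by rewrite ge0_fin_numE// (le_lt_trans (cube_slice_le1 _ _))// ltry.
Qed.

(** The reflection that swaps the first basis vector and the unit normal maps the
    span of the other basis vectors to the direction of the hyperplane. *)
Lemma hyperplane_isometric_ex m (a : 'rV[R]_m.+1) b : 0 < dotprod a a ->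
  exists2 f : 'rV[R]_m -> 'rV[R]_m.+1, isometric f &
    range f = [set x | dotprod x a = b].
Proof.
move=> a0; pose N := dotprod a a.
have sN : 0 < Num.sqrt N by rewrite sqrtr_gt0.
pose u := (Num.sqrt N)^-1 *: a.
have aE : a = Num.sqrt N *: u by rewrite scalerA mulfV ?gt_eqF// scale1r.
have uu : dotprod u u = 1.
  rewrite dotprodZl dotprodZr -/N -[X in _ * (_ * X)]sqr_sqrtr ?ltW//.
  by field; exact: lt0r_neq0.
clearbody u.
pose e : 'rV[R]_m.+1 := delta_mx 0 ord0.
have ee : dotprod e e = 1 by rewrite dotprod_delta mxE !eqxx.
pose h := householder (e - u).
have he : h e = u by apply: householder_swap; rewrite ee.
have hu : h u = e by rewrite -{1}he /h householderK.
pose j (y : 'rV[R]_m) : 'rV[R]_m.+1 :=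
  \row_i (if unlift ord0 i is Some k then y 0 k else 0).
pose f y := h (j y) + (b / Num.sqrt N) *: u.
exists f.
  move=> x y; rewrite /f opprD addrACA subrr addr0.
  rewrite householder_isometric; congr Num.sqrt.
  rewrite /dotprod big_ord_recl !mxE unlift_none subrr mul0r add0r.
  by apply: eq_bigr => i _; rewrite !mxE liftK.
apply/seteqP; split => [_ [y _ <-]|x xa].
  rewrite /f/= dotprodDl aE !dotprodZr dotprodZl uu mulr1.
  rewrite dotprod_householderC -/h hu dotprod_delta mxE unlift_none mulr0 add0r.
  by rewrite mulrC divfK// gt_eqF.
pose z := h (x - (b / Num.sqrt N) *: u).
have z0 : z 0 ord0 = 0.
  rewrite -dotprod_delta -/e /z dotprod_householderC -/h he.
  rewrite dotprodBl dotprodZl uu mulr1 -xa [in X in _ - X]aE dotprodZr.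
  by field; exact: lt0r_neq0.
exists (\row_i z 0 (lift ord0 i)) => //.
rewrite /f (_ : j _ = z).
  by rewrite /z /h householderK subrK.
apply/rowP => i; rewrite mxE; case: unliftP => [k ->|->]; first by rewrite mxE.
by rewrite z0.
Qed.

Lemma graph_point_cube m (a : 'rV[R]_m.+1) b : (forall i, a 0 i ^+ 2 = 1) ->
  [set y | @cube R m.+1 (graph_point a b y)] =
  cube_slice (fun i => a 0 (lift ord0 i)) (b - dotprod (cube_center m.+1) a).
Proof.
move=> a1.
have a0 : a 0 ord0 = 1 \/ a 0 ord0 = -1.
  have /eqP := a1 ord0; rewrite sqrf_eq1 => /orP[] /eqP; by [left|right].
have E y : a 0 ord0 * (b - \sum_i a 0 (lift ord0 i) * tnth y i) =
   a 0 ord0 * (b - dotprod (cube_center m.+1) a -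
     \sum_i a 0 (lift ord0 i) * (tnth y i - 2^-1)) + 2^-1.
  have -> : dotprod (cube_center m.+1) a =
      2^-1 * (a 0 ord0 + \sum_(i < m) a 0 (lift ord0 i)).
    by rewrite -big_ord_recl mulr_sumr; apply: eq_bigr => i _; rewrite mxE.
  have -> : \sum_i a 0 (lift ord0 i) * (tnth y i - 2^-1) =
      \sum_i a 0 (lift ord0 i) * tnth y i - 2^-1 * \sum_(i < m) a 0 (lift ord0 i).
    by rewrite mulr_sumr -sumrB; apply: eq_bigr => i _; ring.
  transitivity (a 0 ord0 * (b - \sum_i a 0 (lift ord0 i) * tnth y i)
    - 2^-1 * a 0 ord0 ^+ 2 + 2^-1); last by ring.
  by rewrite a1 mulr1 subrK.
apply/seteqP; split => y.
  move=> H; split; first by move=> i; have := H (lift ord0 i); rewrite rV_of_consS.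
  have := H ord0; rewrite rV_of_cons0 E.
  by case: a0 => ->; rewrite ler_norml; lra.
move=> [H1 H2] i; case: (unliftP ord0 i) => [k ->|->].
  by rewrite rV_of_consS; exact: H1.
rewrite rV_of_cons0 E; move: H2.
by case: a0 => ->; rewrite ler_norml; lra.
Qed.

(** The diagonal and the side of the center on which the hyperplane lies are
    arbitrary, hence unknown signs for [a] and [s]. *)
Theorem diagonal_section_volumeE m t v :
  diagonal_section_volume m.+1 t v ->
  exists (a : 'I_m -> R) (s : R), [/\ forall i, a i ^+ 2 = 1,
    `|s| = Num.sqrt m.+1%:R * t &
    v = Num.sqrt m.+1%:R * fine (lam m (cube_slice a s))].
Proof.
move=> [H [[w wv [aN0 [b HE]]] dH vE]].
set a := opposite_vertex w - w in aN0 HE.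
have a1 i : a 0 i ^+ 2 = 1.
  by rewrite /a !mxE; case: (wv i) => ->; ring.
have aa := dotprod_signs a1.
have aa0 : 0 < dotprod a a by rewrite aa ltr0n.
exists (fun i => a 0 (lift ord0 i)), (b - dotprod (cube_center m.+1) a).
split => [i||]; first exact: a1.
  move: dH; rewrite HE eucl_dist_hyperplane// aa distrC => <-.
  by rewrite mulrC divfK// gt_eqF// sqrtr_gt0.
rewrite vE /hyperplane_volume; case: xgetP => [x xE [f [fi fH ->]]|none].
  have -> : lebesgue_rV (f @^-1` (H `&` @cube R m.+1)) =
     lam m [set y | @cube R m.+1 (f (rV_of y))].
    congr (lam m _); apply/seteqP; split => y /=; first by move=> [].
    by split => //; rewrite -fH.
  rewrite (isometric_hyperplane_cube a1 fi (etrans fH HE)) graph_point_cube// fineM//.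
  exact: cube_slice_fin.
have [f fi fH] := @hyperplane_isometric_ex m a b aa0.
by have := none (lebesgue_rV (f @^-1` (H `&` @cube R m.+1))); case; exists f; rewrite HE.
Qed.

End Volume.

(** * Integrals over the half-line *)

Section HalfLine.
Context {R : realType}.
Local Notation mu := (@lebesgue_measure R).
Local Notation D := (`[(0:R), +oo[%classic).
Implicit Types (f F : R -> R).

Lemma measurable_invr : measurable_fun setT (fun x : R => x^-1).
Proof.
rewrite -(setvU [set 0]); apply/measurable_funU => //.
  exact: measurableC.
split; last exact: measurable_fun_set1.
have -> : ~` [set 0] = [set x : R | x != 0].
  by apply/seteqP; split => x /= /eqP.
apply: open_continuous_measurable_fun; first exact: open_neq.
by move=> x; rewrite inE/= => x0; apply: cvgV.
Qed.

Lemma is_derive_continuous f (df : R -> R) :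
  (forall x : R, is_derive x 1 f (df x)) -> continuous f.
Proof.
move=> fd x; apply: differentiable_continuous; apply/derivable1_diffP.
by have [] := fd x.
Qed.

Lemma integral_ge0_FTC2y f F (l : R) :
  (forall x : R, is_derive x 1 F (f x)) -> continuous f ->
  (forall x : R, 0 <= x -> 0 <= f x) -> F x @[x --> +oo] --> l ->
  (\int[mu]_(x in D) (f x)%:E = (l - F 0)%:E)%E.
Proof.
move=> dF cf f0 Fl; have cF := is_derive_continuous dF.
rewrite (ge0_continuous_FTC2y _ _ Fl)//.
- exact: continuous_subspaceT.
- by apply: cvg_at_right_filter; exact: cF.
- by move=> x _; rewrite derive1E; have [_ ->] := dF x.
Qed.

Lemma cvg_le_inv f (C : R) : (forall x : R, 1 <= x -> `|f x| <= C / x) ->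
  f x @[x --> +oo] --> (0:R).
Proof.
move=> fC; apply: norm_cvg0.
apply: (@squeeze_cvgr _ _ _ _ (cst 0) (fun x => C * x^-1)).
- near=> x; rewrite normr_ge0/=; apply: fC.
  near: x; exact: nbhs_pinfty_ge.
- exact: cvg_cst.
- rewrite -[X in _ --> X](mulr0 C); apply: cvgMl_tmp.
  by apply/gtr0_cvgV0 => //; exact: nbhs_pinfty_gt.
Unshelve. all: end_near. Qed.

Lemma integrable_oneDsqrV : mu.-integrable D (EFin \o (fun x => (oneDsqr x)^-1)).
Proof.
have mc : measurable_fun setT (fun x : R => (oneDsqr x)^-1).
  by apply: continuous_measurable_fun; exact: continuous_oneDsqrV.
apply/integrableP; split; first by apply/measurable_EFinP; exact: measurable_funTS.
rewrite [X in (X < _)%E](_ : _ = (pi / 2)%:E) ?ltry//.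
rewrite -integral0y_oneDsqr; apply: eq_integral => x _ /=.
by rewrite ger0_norm// invr_ge0 (le_trans ler01).
Qed.

Lemma lorentz_integrable f (C : R) : measurable_fun setT f ->
  (forall x : R, 0 <= x -> `|f x| <= C * (oneDsqr x)^-1) -> mu.-integrable D (EFin \o f).
Proof.
move=> mf fC.
apply: (le_integrable _ _ _ (integrableZl _ C integrable_oneDsqrV)) => //.
  by apply/measurable_EFinP; exact: measurable_funTS.
move=> x /=; rewrite in_itv/= andbT => x0.
by rewrite lee_fin (le_trans (fC _ x0))// ler_norm.
Qed.

Lemma Rintegral_oneDsqrV : \int[mu]_(x in D) (oneDsqr x)^-1 = pi / 2.
Proof. by rewrite /Rintegral integral0y_oneDsqr. Qed.

(** Adding [C / (1 + x^2)], with antiderivative [C * atan], reduces to the case of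
    a nonnegative integrand. *)
Lemma Rintegral_FTC2y f F (C l : R) :
  (forall x : R, is_derive x 1 F (f x)) -> continuous f ->
  (forall x : R, 0 <= x -> `|f x| <= C * (oneDsqr x)^-1) ->
  F x @[x --> +oo] --> l ->
  \int[mu]_(x in D) f x = l - F 0.
Proof.
move=> dF cf fC Fl.
have mf := continuous_measurable_fun cf.
have fi := lorentz_integrable mf fC.
have H : (\int[mu]_(x in D) (f x + C * (oneDsqr x)^-1)%:E =
    (l + C * (pi / 2) - (F 0 + C * atan 0))%:E)%E.
  apply: (@integral_ge0_FTC2y _ (fun x => F x + C * atan x)).
  - move=> x; apply: cvgD; first exact: cf.
    by apply: cvgMl_tmp; exact: continuous_oneDsqrV.
  - move=> x x0; have := fC x x0; rewrite ler_norml => /andP[+ _].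
    by rewrite -subr_ge0 opprK.
  - by apply: cvgD => //; apply: cvgMl_tmp; exact: cvgy_atan.
apply: (addIr (C * (pi / 2))).
transitivity (\int[mu]_(x in D) (f x + C * (oneDsqr x)^-1)); last first.
  by rewrite /Rintegral H atan0 mulr0 addr0 /= addrAC.
rewrite RintegralD//; last exact: (integrableZl _ C integrable_oneDsqrV).
by rewrite RintegralZl ?Rintegral_oneDsqrV//; exact: integrable_oneDsqrV.
Qed.

End HalfLine.

Section Fubini.
Context {R : realType}.
Local Notation mu := (@lebesgue_measure R).
Local Open Scope ereal_scope.

Lemma iterated_integral_patch (A B : set R) (h : R -> R -> R) :
  \int[mu]_(x in A) \int[mu]_(y in B) (h x y)%:E =
  \int[mu]_x \int[mu]_y (h x y * (\1_A x * \1_B y))%:E.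
Proof.
rewrite integral_mkcond; apply: eq_integral => x _; rewrite patchE indicE.
case: ifPn => xA; last first.
  by apply/esym/integral0_eq => y _; rewrite mul0r mulr0.
rewrite integral_mkcond; apply: eq_integral => y _.
by rewrite patchE indicE mul1r; case: ifPn => _; rewrite ?mulr1 ?mulr0.
Qed.

Lemma measurable_patch2 (A B : set R) (h : R -> R -> R) :
  measurable A -> measurable B ->
  measurable_fun setT (fun p : R * R => h p.1 p.2) ->
  measurable_fun setT (fun p : R * R => (h p.1 p.2 * (\1_A p.1 * \1_B p.2))%:E).
Proof.
move=> mA mB mh; apply/measurable_EFinP; apply: measurable_funM => //.
apply: measurable_funM.
  exact: (measurableT_comp (measurable_indic mA)).
exact: (measurableT_comp (measurable_indic mB)).
Qed.

Lemma tonelli_set (A B : set R) (h : R -> R -> R) :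
  measurable A -> measurable B ->
  measurable_fun setT (fun p : R * R => h p.1 p.2) ->
  (forall x y, A x -> B y -> (0 <= h x y)%R) ->
  \int[mu]_(x in A) \int[mu]_(y in B) (h x y)%:E =
  \int[mu]_(y in B) \int[mu]_(x in A) (h x y)%:E.
Proof.
move=> mA mB mh h0.
rewrite iterated_integral_patch (iterated_integral_patch B A (fun y x => h x y)).
have /= -> := fubini_tonelli (m1 := mu) (m2 := mu) _ (measurable_patch2 mA mB mh).
  by apply: eq_integral => y _; apply: eq_integral => x _; rewrite [(\1_B y * _)%R]mulrC.
move=> [x y]; rewrite lee_fin/= !indicE.
case: (boolP (x \in A)) => [|_]; last by rewrite mul0r mulr0.
case: (boolP (y \in B)) => [|_]; last by rewrite !mulr0.
by rewrite !inE !mulr1 => By Ax; exact: h0.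
Qed.

Lemma fubini_set (A B : set R) (h : R -> R -> R) (g : R -> R) :
  measurable A -> measurable B -> mu A < +oo ->
  measurable_fun setT (fun p : R * R => h p.1 p.2) ->
  measurable_fun setT g -> mu.-integrable B (EFin \o g) ->
  (forall x y, A x -> B y -> (`|h x y| <= g y)%R) ->
  \int[mu]_(x in A) \int[mu]_(y in B) (h x y)%:E =
  \int[mu]_(y in B) \int[mu]_(x in A) (h x y)%:E.
Proof.
move=> mA mB Aoo mh mg gi hg.
rewrite iterated_integral_patch (iterated_integral_patch B A (fun y x => h x y)).
have /= -> := @Fubini _ _ _ _ R mu mu
    (fun p : R * R => (h p.1 p.2 * (\1_A p.1 * \1_B p.2))%:E).
  by apply: eq_integral => y _; apply: eq_integral => x _; rewrite [(\1_B y * _)%R]mulrC.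
have mg2 : measurable_fun setT (fun p : R * R => `|g p.2|%R).
  by apply: measurableT_comp => //; exact: (measurableT_comp mg).
have ki : (mu \x mu).-integrable setT
    (fun p : R * R => (`|g p.2|%R * (\1_A p.1 * \1_B p.2))%:E).
  apply/integrable12ltyP; first exact: (@measurable_patch2 A B (fun _ y => `|g y|%R)).
  rewrite (_ : (integral _ _ _) =
    \int[mu]_(x in A) \int[mu]_(y in B) `|g y|%:E); last first.
    rewrite (iterated_integral_patch A B (fun x y => `|g y|%R)).
    apply: eq_integral => x _; apply: eq_integral => y _ /=.
    by rewrite ger0_norm// !mulr_ge0// indicE.
  rewrite integral_cst//.
  apply: lte_mul_pinfty => //; first by apply: integral_ge0 => y _; rewrite lee_fin.
  by apply: integrable_fin_num => //; exact: integrable_norm gi.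
apply: le_integrable ki => //; first exact: measurable_patch2.
move=> [x y] _ /=; rewrite lee_fin !normrM normr_id.
rewrite !indicE; case: (boolP (x \in A)) => [|_]; last by rewrite normr0 !(mul0r, mulr0).
case: (boolP (y \in B)) => [|_]; last by rewrite normr0 !mulr0.
rewrite !inE !normr1 !mulr1 => By Ax.
by rewrite (le_trans (hg _ _ Ax By))// ler_norm.
Qed.

End Fubini.

(** * The integral of (1 - cos (a u)) / u^2 *)

Section FejerIntegral.
Context {R : realType}.
Local Notation mu := (@lebesgue_measure R).
Local Notation D := (`[(0:R), +oo[%classic).
Local Notation P := (`](0:R), +oo[%classic).
Implicit Types x y u a : R.

Lemma expRN_le n x : 0 < x -> expR (- x) <= n.+1`!%:R / x ^+ n.+1.
Proof.
move=> x0; rewrite expRN -[leRHS]invrK lef_pV2 ?posrE ?expR_gt0 ?invr_gt0 ?divr_gt0 ?exprn_gt0 ?ltr0n ?fact_gt0//.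
rewrite invf_div; apply: le_trans (expR_ge1Dxn n (ltW x0)).
by rewrite lerDr.
Qed.

Lemma integral_open_halfline (f : R -> R) : measurable_fun setT f ->
  (\int[mu]_(x in P) (f x)%:E = \int[mu]_(x in D) (f x)%:E)%E.
Proof.
move=> mf; rewrite integral_itv_obnd_cbnd//.
by apply/measurable_EFinP; exact: measurable_funTS.
Qed.

Lemma versin_ge0 u a : 0 <= 1 - cos (a * u).
Proof. by rewrite subr_ge0 cos_le1. Qed.

Lemma integral_mulx_expRN u c : 0 < u -> 0 <= c ->
  (\int[mu]_(y in P) (c * (y * expR (- (u * y))))%:E = (c / u ^+ 2)%:E)%E.
Proof.
move=> u0 c0.
have dF y : is_derive y 1 (fun y => - c * ((y / u + u ^- 2) * expR (- (u * y))))
    (c * (y * expR (- (u * y)))).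
  apply: is_derive_eq; rewrite /GRing.scale/=; field; exact: lt0r_neq0.
have df y : is_derive y 1 (fun y => c * (y * expR (- (u * y))))
    (c * (expR (- (u * y)) - u * y * expR (- (u * y)))).
  by apply: is_derive_eq; rewrite /GRing.scale/=; ring.
have cf := is_derive_continuous df.
rewrite integral_open_halfline; last exact: continuous_measurable_fun.
rewrite (integral_ge0_FTC2y dF cf (l := 0)).
- by congr EFin; rewrite !mul0r mulr0 oppr0 expR0; ring.
- by move=> y y0; rewrite !mulr_ge0// expR_ge0.
apply: (@cvg_le_inv _ _ (c * (2 * (u^-1 + u ^- 2) / u ^+ 2))) => y y1.
have y0 : 0 < y by exact: lt_le_trans y1.
have := @expRN_le 1 (u * y) (mulr_gt0 u0 y0) => E.
rewrite !normrM normrN (ger0_norm c0) ger0_norm; last first.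
  by rewrite addr_ge0// ?divr_ge0// ?invr_ge0 ?exprn_ge0// ltW.
rewrite ger0_norm ?expR_ge0// -!mulrA ler_wpM2l//.
apply: (@le_trans _ _ ((y * u^-1 + u ^- 2 * y) * (2%:R / (u * y) ^+ 2))).
  apply: ler_pM E; rewrite ?expR_ge0//.
    by rewrite addr_ge0// ?divr_ge0// ?invr_ge0 ?exprn_ge0// ltW.
  rewrite lerD2l ler_peMr// invr_ge0 exprn_ge0// ltW//.
rewrite le_eqVlt; apply/orP; left; apply/eqP; field.
by rewrite !lt0r_neq0.
Qed.

Lemma integral_versin_expRN y a : 0 < y ->
  (\int[mu]_(u in P) ((1 - cos (a * u)) * (y * expR (- (u * y))))%:E
   = (a ^+ 2 / (a ^+ 2 + y ^+ 2))%:E)%E.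
Proof.
move=> y0.
have ay0 : 0 < a ^+ 2 + y ^+ 2 by rewrite ltr_wpDl ?sqr_ge0// exprn_gt0.
have dF u : is_derive u 1 (fun u => - expR (- (u * y)) +
     y / (a ^+ 2 + y ^+ 2) * (expR (- (u * y)) * (y * cos (a * u) - a * sin (a * u))))
    ((1 - cos (a * u)) * (y * expR (- (u * y)))).
  by apply: is_derive_eq; rewrite /GRing.scale/=; field; exact: lt0r_neq0.
have df u : is_derive u 1 (fun u => (1 - cos (a * u)) * (y * expR (- (u * y))))
    (a * sin (a * u) * (y * expR (- (u * y))) - (1 - cos (a * u)) * (y * (y * expR (- (u * y))))).
  by apply: is_derive_eq; rewrite /GRing.scale/=; ring.
have cf := is_derive_continuous df.
rewrite integral_open_halfline; last exact: continuous_measurable_fun.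
rewrite (integral_ge0_FTC2y dF cf (l := 0)).
- congr EFin; rewrite mul0r mulr0 oppr0 expR0 cos0 sin0; field; exact: lt0r_neq0.
- move=> u u0; rewrite !mulr_ge0// ?versin_ge0 ?expR_ge0//; exact: ltW.
apply: (@cvg_le_inv _ _ ((1 + y / (a ^+ 2 + y ^+ 2) * (y + `|a|)) / y)) => u u1.
have u0 : 0 < u by exact: lt_le_trans u1.
have := @expRN_le 0 (u * y) (mulr_gt0 u0 y0); rewrite expr1 => E.
apply: (@le_trans _ _ ((1 + y / (a ^+ 2 + y ^+ 2) * (y + `|a|)) * expR (- (u * y)))).
  rewrite mulrDl mul1r (le_trans (ler_normD _ _))// normrN.
  have k0 : 0 <= y / (a ^+ 2 + y ^+ 2) by rewrite divr_ge0// ltW.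
  rewrite (ger0_norm (expR_ge0 _)) lerD2l normrM (ger0_norm k0).
  rewrite normrM (ger0_norm (expR_ge0 _)) -mulrA ler_wpM2l// mulrC ler_wpM2r ?expR_ge0//.
  rewrite (le_trans (ler_normB _ _))// !normrM lerD//.
    by rewrite (gtr0_norm y0) ler_piMr ?cos_max// ltW.
  by rewrite ler_piMr ?sin_max.
rewrite -[leRHS]mulrA -invfM [y * u]mulrC.
rewrite ler_wpM2l//; last by move: E; rewrite (_ : 1`! = 1)%N// div1r.
by rewrite addr_ge0// mulr_ge0 ?addr_ge0 ?divr_ge0 ?normr_ge0 ?(ltW y0) ?(ltW ay0).
Qed.

Lemma integral_cauchy_kernel a : 0 < a ->
  (\int[mu]_(y in P) (a ^+ 2 / (a ^+ 2 + y ^+ 2))%:E = (a * (pi / 2))%:E)%E.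
Proof.
move=> a0.
have ay0 y : 0 < a ^+ 2 + y ^+ 2 by rewrite ltr_wpDr ?sqr_ge0// exprn_gt0.
have ay1 y : a ^+ 2 + y ^+ 2 != 0 by exact: lt0r_neq0.
have dF y : is_derive y 1 (fun y => a * atan (y / a)) (a ^+ 2 / (a ^+ 2 + y ^+ 2)).
  apply: is_derive_eq; rewrite /GRing.scale/=; field.
  by rewrite ay1 lt0r_neq0.
have cf : continuous (fun y => a ^+ 2 / (a ^+ 2 + y ^+ 2)).
  move=> y; apply: cvgMl_tmp; apply: cvgV => //.
  apply: cvgD; [exact: cvg_cst|exact: exprn_continuous].
rewrite integral_open_halfline; last exact: continuous_measurable_fun.
rewrite (integral_ge0_FTC2y dF cf (l := a * (pi / 2))).
- by rewrite mul0r atan0 mulr0 subr0.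
- by move=> y _; rewrite divr_ge0 ?sqr_ge0// ltW.
apply: cvgMl_tmp; apply: (cvg_comp (fun y => y / a) atan); last exact: cvgy_atan.
apply: gt0_cvgMly => //.
by rewrite invr_gt0.
Qed.

(** Write [1 / u^2] as the integral of [y * exp (- u * y)] over [y] and exchange the
    integrals: the one over [u] becomes [a^2 / (a^2 + y^2)], which integrates to an
    arctangent. *)
Lemma fejer_integral a :
  (\int[mu]_(u in D) ((1 - cos (a * u)) / u ^+ 2)%:E = (`|a| * (pi / 2))%:E)%E.
Proof.
have [->|a0] := eqVneq a 0.
  rewrite normr0 mul0r; apply: integral0_eq => u _.
  by rewrite mul0r cos0 subrr mul0r.
wlog: a a0 / 0 < a => [H|ap].
  have [ap|] := ltP 0 a; first exact: H.
  rewrite le_eqVlt (negbTE a0)/= => an.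
  rewrite -normrN -H ?oppr_eq0 ?oppr_gt0//.
  by apply: eq_integral => u _; rewrite mulNr cosN.
rewrite -integral_open_halfline; last first.
  apply: measurable_funM.
    apply: measurable_funB => //; apply: measurableT_comp.
      by apply: continuous_measurable_fun; exact: continuous_cos.
    exact: measurable_funM.
  by apply: (measurableT_comp measurable_invr); exact: measurable_funX.
transitivity (\int[mu]_(u in P) \int[mu]_(y in P)
    ((1 - cos (a * u)) * (y * expR (- (u * y))))%:E)%E.
  apply: eq_integral => u; rewrite inE/= in_itv/= andbT => u0.
  by rewrite integral_mulx_expRN// versin_ge0.
rewrite tonelli_set//.
- rewrite gtr0_norm// -(integral_cauchy_kernel ap); apply: eq_integral => y.
  by rewrite inE/= in_itv/= andbT => y0; rewrite integral_versin_expRN.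
- apply: measurable_funM.
    apply: measurable_funB => //; apply: measurableT_comp.
      by apply: continuous_measurable_fun; exact: continuous_cos.
    exact: measurable_funM.
  apply: measurable_funM => //; apply: measurableT_comp => //.
  apply: measurableT_comp => //; exact: measurable_funM.
- move=> u y /=; rewrite !in_itv/= !andbT => u0 y0.
  by rewrite !mulr_ge0 ?versin_ge0 ?expR_ge0// ltW.
Qed.

End FejerIntegral.

(** * The sinc function *)

Section Sinc.
Context {R : realType}.
Local Notation mu := (@lebesgue_measure R).
Local Notation D := (`[(0:R), +oo[%classic).
Implicit Types x y u s : R.

(** By the convention [x / 0 = 0], [sinc 0 = 0].  Integrals do not see it, but
    Taylor estimates hold away from 0 only. *)
Definition sinc x := sin x / x.

Lemma sinc0 : sinc 0 = 0. Proof. by rewrite /sinc invr0 mulr0. Qed.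

Lemma le_at0_of_derive_ge0 (f df : R -> R) : (forall x : R, is_derive x 1 f (df x)) ->
  (forall x, 0 <= x -> 0 <= df x) -> forall x, 0 <= x -> f 0 <= f x.
Proof.
move=> fd df0 x; rewrite le_eqVlt => /predU1P[<-//|x0].
have [c|c] := @MVT_segment _ f df 0 x (ltW x0) (fun z _ => fd z).
  by apply: continuous_subspaceT; exact: is_derive_continuous fd.
rewrite in_itv/= => /andP[c0 _] E.
by rewrite -subr_ge0 E subr0 mulr_ge0// ?df0// ltW.
Qed.

Lemma sin_le x : 0 <= x -> sin x <= x.
Proof.
move=> x0; rewrite -subr_ge0.
have := @le_at0_of_derive_ge0 (fun x => x - sin x) (fun x => 1 - cos x).
rewrite sin0 subrr; apply => //.
Qed.

Lemma norm_sin_le x : `|sin x| <= `|x|.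
Proof.
wlog x0 : x / 0 <= x => [H|].
  have [|x0] := leP 0 x; first exact: H.
  by rewrite -normrN -sinN -[leRHS]normrN H// oppr_ge0 ltW.
rewrite (ger0_norm x0) ler_norml sin_le// andbT lerNl.
have := @le_at0_of_derive_ge0 (fun x => x + sin x) (fun x => 1 + cos x).
rewrite sin0 addr0 => H.
rewrite -subr_ge0 opprK; apply: H => //.
Qed.

Lemma norm_sinc_le1 x : `|sinc x| <= 1.
Proof.
have [->|x0] := eqVneq x 0; first by rewrite sinc0 normr0.
by rewrite normrM normfV ler_pdivrMr ?normr_gt0// mul1r norm_sin_le.
Qed.

Lemma norm_sinc_le x : `|sinc x| <= `|x|^-1.
Proof. by rewrite normrM normfV ler_piMl// ?sin_max// invr_ge0. Qed.

Lemma sinc_sqr_le u : sinc (u / 2) ^+ 2 <= 5 * (oneDsqr u)^-1.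
Proof.
have o0 : 0 < oneDsqr u by exact: lt_le_trans (oneDsqr_ge1 u).
rewrite ler_pdivlMr//.
have [u2|u2] := ltP (u ^+ 2) 4.
  apply: (@le_trans _ _ (1 * oneDsqr u)); last by rewrite /oneDsqr; lra.
  rewrite ler_wpM2r ?(ltW o0)//.
  by rewrite -real_normK ?num_real// expr_le1// norm_sinc_le1.
have u0 : u != 0 by apply: contraTneq u2 => ->; rewrite expr0n/=; lra.
apply: (@le_trans _ _ (4 / u ^+ 2 * oneDsqr u)).
  rewrite ler_wpM2r ?(ltW o0)// -real_normK ?num_real//.
  have -> : 4 / u ^+ 2 = `|u / 2|^-1 ^+ 2.
    by rewrite exprVn real_normK ?num_real//; field.
  by rewrite ler_sqr ?nnegrE// ?norm_sinc_le// invr_ge0.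
rewrite mulrAC ler_pdivrMr; last by lra.
by rewrite /oneDsqr; lra.
Qed.

Lemma measurable_sin : measurable_fun setT (@sin R).
Proof. apply: continuous_measurable_fun; exact: continuous_sin. Qed.
Lemma measurable_cos : measurable_fun setT (@cos R).
Proof. apply: continuous_measurable_fun; exact: continuous_cos. Qed.
Lemma measurable_sinc : measurable_fun setT sinc.
Proof. apply: measurable_funM; [exact: measurable_sin|exact: measurable_invr]. Qed.

Definition sinc_kernel m s u := sinc (u / 2) ^+ m * cos (u * s).

Lemma sinc_kernel_le m s u : `|sinc_kernel m.+2 s u| <= 5 * (oneDsqr u)^-1.
Proof.
apply: le_trans (sinc_sqr_le u).
have -> : `|sinc_kernel m.+2 s u| =
    `|sinc (u / 2)| ^+ 2 * (`|sinc (u / 2)| ^+ m * `|cos (u * s)|).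
  by rewrite /sinc_kernel normrM normrX mulrA -exprD.
rewrite -[sinc _ ^+ 2 in leRHS]real_normK ?num_real// -[leRHS]mulr1.
rewrite ler_wpM2l ?exprn_ge0// mulr_ile1 ?exprn_ge0// ?cos_max//.
by rewrite exprn_ile1 ?norm_sinc_le1.
Qed.

Lemma measurable_sinc_kernel2 m (g : R * R -> R) :
  measurable_fun setT g ->
  measurable_fun setT (fun p : R * R => sinc_kernel m (g p) p.2).
Proof.
move=> mg; apply: measurable_funM.
  apply: measurable_funX; apply: (measurableT_comp measurable_sinc).
  exact: measurable_funM.
by apply: (measurableT_comp measurable_cos); exact: measurable_funM.
Qed.

Lemma measurable_sinc_kernel m s : measurable_fun setT (sinc_kernel m s).
Proof.
apply: measurable_funM.
  apply: measurable_funX; apply: (measurableT_comp measurable_sinc).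
  exact: measurable_funM.
by apply: (measurableT_comp measurable_cos); exact: measurable_funM.
Qed.

Lemma integrable_sinc_kernel m s :
  mu.-integrable D (EFin \o sinc_kernel m.+2 s).
Proof.
apply: (lorentz_integrable (measurable_sinc_kernel _ _)) => u _.
exact: sinc_kernel_le.
Qed.

Definition sinc_integral m s := \int[mu]_(u in D) sinc_kernel m s u.

Lemma sinc_integralE m s : (sinc_integral m.+2 s)%:E =
  (\int[mu]_(u in D) (sinc_kernel m.+2 s u)%:E)%E.
Proof. by rewrite /sinc_integral /Rintegral fineK// integrable_fin_num//; exact: integrable_sinc_kernel. Qed.

Lemma integral01_FTC (f F : R -> R) :
  (forall x : R, is_derive x 1 F (f x)) -> continuous f ->
  (\int[mu]_(x in `[0%R, 1%R]) (f x)%:E = (F 1 - F 0)%:E)%E.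
Proof.
move=> dF cf; have cF := is_derive_continuous dF.
rewrite (@continuous_FTC2 _ f F)//.
- exact: continuous_subspaceT.
- split => //.
  + by apply: cvg_at_right_filter; exact: cF.
  + by apply: cvg_at_left_filter; exact: cF.
- by move=> x _; rewrite derive1E; have [_ ->] := dF x.
Qed.

(** Averaging [cos (u * s)] over [s] in a unit interval multiplies it by
    [sinc (u / 2)].  Both sides are 0 at [u = 0], where [sinc] vanishes. *)
Lemma sinc_kernel_average m (c a0 s u : R) : a0 ^+ 2 = 1 ->
  (\int[mu]_(x in `[0%R, 1%R]) (c * sinc_kernel m.+1 (s - a0 * (x - 2^-1)) u)%:E =
   (c * sinc_kernel m.+2 s u)%:E)%E.
Proof.
move=> a1; have a0' : a0 = 1 \/ a0 = -1.
  by have /eqP := a1; rewrite sqrf_eq1 => /orP[] /eqP; by [left|right].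
have an0 : a0 != 0 by case: a0' => ->; rewrite ?oppr_eq0 oner_eq0.
have [->|u0] := eqVneq u 0.
  rewrite /sinc_kernel !mul0r sinc0 !expr0n/= !mul0r.
  rewrite mulr0.
  by apply: integral0_eq => x _; rewrite mul0r mulr0.
under eq_integral do rewrite /sinc_kernel mulrA.
set g := c * sinc (u / 2) ^+ m.+1.
have dF x : is_derive x 1 (fun x => - g / (u * a0) * sin (u * (s - a0 * (x - 2^-1))))
   (g * cos (u * (s - a0 * (x - 2^-1)))).
  by apply: is_derive_eq; rewrite /GRing.scale/=; field; rewrite u0 an0.
have df x : is_derive x 1 (fun x => g * cos (u * (s - a0 * (x - 2^-1))))
   (g * (u * a0 * sin (u * (s - a0 * (x - 2^-1))))).
  by apply: is_derive_eq; rewrite /GRing.scale/=; ring.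
rewrite (integral01_FTC dF (is_derive_continuous df)).
congr EFin; rewrite /sinc_kernel exprSr !mulrA -/g /sinc.
have -> : u * (s - a0 * (1 - 2^-1)) = u * s - a0 * (u / 2) by field.
have -> : u * (s - a0 * (0 - 2^-1)) = u * s + a0 * (u / 2) by field.
rewrite sinB sinD.
case: a0' => ->; rewrite ?mulN1r ?sinN ?cosN ?mul1r; field; rewrite u0 ?oppr_eq0 ?oner_eq0//.
Qed.

End Sinc.

(** * Fourier formula for slices of the cube *)

Section FourierSlice.
Context {R : realType}.
Local Notation Rm := (measurableTypeR R).
Local Notation lam := (@lebesgue_tuple R).
Local Notation mu := (@lebesgue_measure R).
Local Notation D := (`[(0:R), +oo[%classic).

Lemma measurable_fejer (a : R) :
  measurable_fun setT (fun u : R => (1 - cos (a * u)) / u ^+ 2).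
Proof.
apply: measurable_funM.
  apply: measurable_funB => //; apply: (measurableT_comp measurable_cos).
  exact: measurable_funM.
by apply: (measurableT_comp measurable_invr); exact: measurable_funX.
Qed.

Lemma integrable_fejer (a : R) :
  mu.-integrable D (EFin \o (fun u => (1 - cos (a * u)) / u ^+ 2)).
Proof.
apply/integrableP; split.
  by apply/measurable_EFinP; apply: measurable_funTS; exact: measurable_fejer.
rewrite [X in (X < _)%E](_ : _ = (`|a| * (pi / 2))%:E) ?ltry//.
rewrite -fejer_integral; apply: eq_integral => u _ /=.
by rewrite ger0_norm// divr_ge0 ?versin_ge0 ?sqr_ge0.
Qed.

Lemma Rintegral_fejer (a : R) :
  \int[mu]_(u in D) ((1 - cos (a * u)) / u ^+ 2) = `|a| * (pi / 2).
Proof. by rewrite /Rintegral fejer_integral. Qed.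

(** The kernel is the second difference in [s], with step 1, of
    [(1 - cos (s * u)) / u^2], so its integral is that of [`|s| * (pi / 2)]: a hat
    function. *)
Lemma sinc_integral2 (s : R) :
  sinc_integral 2 s = pi * Num.max 0 (1 - `|s|).
Proof.
transitivity (\int[mu]_(u in D) (((1 - cos ((s + 1) * u)) / u ^+ 2 +
   (1 - cos ((s - 1) * u)) / u ^+ 2) - 2 * ((1 - cos (s * u)) / u ^+ 2))).
  apply: eq_Rintegral => u _.
  have [->|u0] := eqVneq u 0.
    by rewrite /sinc_kernel !mulr0 cos0 !mul0r sinc0 expr0n/= mul0r subrr !mul0r; ring.
  have -> : (s + 1) * u = s * u + (u / 2 + u / 2) by field.
  have -> : (s - 1) * u = s * u - (u / 2 + u / 2) by field.
  rewrite cosB cosD (cosD (u / 2)) -!expr2 cos2sin2 /sinc_kernel /sinc [u * s]mulrC.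
  by field.
have i1 := integrable_fejer (s + 1); have i2 := integrable_fejer (s - 1).
have i3 := integrable_fejer s.
have i12 : mu.-integrable D (EFin \o (fun u => (1 - cos ((s + 1) * u)) / u ^+ 2 +
    (1 - cos ((s - 1) * u)) / u ^+ 2)) by exact: (integrableD _ i1 i2).
have i3' : mu.-integrable D (EFin \o (fun u => 2 * ((1 - cos (s * u)) / u ^+ 2))).
  exact: (integrableZl _ 2 i3).
rewrite RintegralB//.
rewrite RintegralD// RintegralZl// !Rintegral_fejer.
have -> : `|s + 1| * (pi / 2) + `|s - 1| * (pi / 2) - 2 * (`|s| * (pi / 2)) =
  pi * ((`|s + 1| + `|s - 1| - 2 * `|s|) / 2) by field.
congr (_ * _).
case: (lerP 0 (1 - `|s|)); case: (ger0P s) => ?; case: (ger0P (s + 1)) => ?;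
  case: (ger0P (s - 1)) => ?; lra.
Qed.

Lemma cube_slice_cons m (a : 'I_m.+1 -> R) (s : R) x (y : m.-tuple Rm) :
  cube_slice a s (cons_pair (x : Rm, y)) <->
  0 <= x <= 1 /\ cube_slice (fun i => a (lift ord0 i)) (s - a ord0 * (x - 2^-1)) y.
Proof.
have E : s - \sum_i a i * (tnth (cons_pair (x : Rm, y)) i - 2^-1) =
    s - a ord0 * (x - 2^-1) - \sum_i a (lift ord0 i) * (tnth y i - 2^-1).
  rewrite big_ord_recl tnth0 opprD addrA; congr (_ - _).
  by apply: eq_bigr => i _; rewrite tnthS.
rewrite /cube_slice/= E; split.
  move=> [H1 H2]; split; first by have := H1 ord0; rewrite tnth0.
  by split => // i; have := H1 (lift ord0 i); rewrite tnthS.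
move=> [H0 [H1 H2]]; split => // i.
by case: (unliftP ord0 i) => [j ->|->]; rewrite ?tnthS ?tnth0.
Qed.

Lemma lebesgue_cube_slice1 (a : 'I_1 -> R) s : (forall i, a i ^+ 2 = 1) ->
  lam 1 (cube_slice a s) = (Num.max 0 (1 - `|s|))%:E.
Proof.
move=> a1; have a0' : a ord0 = 1 \/ a ord0 = -1.
  by have /eqP := a1 ord0; rewrite sqrf_eq1 => /orP[] /eqP; by [left|right].
pose t := a ord0 * s.
pose lo : R := if 0 <= t then t else 0; pose hi : R := if 0 <= t then 1 else 1 + t.
pose I : set R := `[lo, hi]%classic.
have IE x : I x <-> 0 <= x <= 1 /\ `|s - a ord0 * (x - 2^-1)| <= 2^-1.
  rewrite /I/= in_itv/= /lo /hi /t ler_norml.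
  case: a0' => ->; case: ifPn => t0;
    by split => [/andP[? ?]|[? ?]]; [split; lra|lra].
have nt : `|t| = `|s| by case: a0' => E; rewrite /t E ?mul1r ?mulN1r ?normrN.
rewrite lebesgue_tupleSE.
transitivity (1 * mu I)%E.
  apply: integral_indic_cst => //; first exact: measurable_itv.
    move=> x xI; apply: lebesgue_tuple0 => /=.
    have [x01 xs] := (IE x).1 xI.
    by apply/cube_slice_cons; split => //; split; [case|rewrite big_ord0 subr0].
  move=> x xI.
  rewrite (_ : [set _ | _] = set0) ?measure0//; apply/seteqP; split => // y.
  rewrite /mkset => /cube_slice_cons[x01 [_]]; rewrite big_ord0 subr0 => H.
  by apply: xI; apply/IE.
rewrite mul1e lebesgue_measure_itv/= lte_fin -nt.
rewrite -EFinB -(fun_if EFin); congr EFin.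
rewrite /lo /hi; case: (ger0P t) => t0; case: ltP => ?;
  [case: (lerP 0 (1 - t)) => ? | case: (lerP 0 (1 - t)) => ?
  |case: (lerP 0 (1 - - t)) => ? | case: (lerP 0 (1 - - t)) => ?]; lra.
Qed.

(** The measure in one more dimension is an average over a unit interval of values
    of [s], and Fubini moves the average under the Fourier integral.  The induction
    starts in dimension 1 because [sinc] itself is not integrable. *)
Theorem lebesgue_cube_slice m (a : 'I_m.+1 -> R) s : (forall i, a i ^+ 2 = 1) ->
  lam m.+1 (cube_slice a s) = (sinc_integral m.+2 s / pi)%:E.
Proof.
elim: m a s => [|m IH] a s a1.
  rewrite lebesgue_cube_slice1// sinc_integral2 mulrAC mulfV ?mul1r//.
  exact/lt0r_neq0/pi_gt0.
rewrite lebesgue_tupleSE.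
transitivity (\int[mu]_(x in `[0%R, 1%R])
    ((sinc_integral m.+2 (s - a ord0 * (x - 2^-1)) / pi)%:E))%E.
  rewrite [RHS]integral_mkcond; apply: eq_integral => x _; rewrite patchE.
  case: ifPn => xI.
    rewrite -(IH (fun i => a (lift ord0 i)))//.
    congr (lam m.+1 _); apply/seteqP; split => y.
      by move=> /cube_slice_cons[].
    move=> ?; apply/cube_slice_cons; split => //.
    by move: xI; rewrite inE/= in_itv.
  rewrite (_ : [set _ | _] = set0) ?measure0//; apply/seteqP; split => // y.
  rewrite /mkset => /cube_slice_cons[x01 _].
  by move: xI; rewrite notin_setE/= in_itv/= x01.
have mI : mu `[(0:R), 1]%classic = 1%E.
  by rewrite lebesgue_measure_itv/= lte_fin ltr01 -EFinB subr0.
pose h x u := pi^-1 * sinc_kernel m.+2 (s - a ord0 * (x - 2^-1)) u.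
have mh : measurable_fun setT (fun p : R * R => h p.1 p.2).
  apply: measurable_funM => //; apply: measurable_sinc_kernel2.
  apply: measurable_funB => //; apply: measurable_funM => //.
  exact: measurable_funB.
have hb x u : `|h x u| <= pi^-1 * 5 * (oneDsqr u)^-1.
  rewrite /h normrM ger0_norm ?invr_ge0 ?pi_ge0// -mulrA ler_wpM2l ?invr_ge0 ?pi_ge0//.
  exact: sinc_kernel_le.
transitivity (\int[mu]_(x in `[0%R, 1%R]) \int[mu]_(u in D) (h x u)%:E)%E.
  apply: eq_integral => x _; rewrite mulrC EFinM sinc_integralE.
  by rewrite -integralZl//; exact: integrable_sinc_kernel.
rewrite (fubini_set (g := fun u => pi^-1 * 5 * (oneDsqr u)^-1))//.
- rewrite mulrC EFinM sinc_integralE -integralZl//; last exact: integrable_sinc_kernel.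
  apply: eq_integral => u _.
  by rewrite /h sinc_kernel_average.
- by rewrite mI ltry.
- apply: measurable_funM => //; apply: continuous_measurable_fun.
  exact: continuous_oneDsqrV.
- exact: (integrableZl _ (pi^-1 * 5) (@integrable_oneDsqrV R)).
Qed.
End FourierSlice.

(** * The section volume as an oscillatory integral *)

Section Scaling.
Context {R : realType}.
Local Notation Rm := (measurableTypeR R).
Local Notation mu := (@lebesgue_measure R).
Local Notation D := (`[(0:R), +oo[%classic).

Lemma ge0_integral_scale (c : R) (f : R -> \bar R) : 0 < c ->
  measurable_fun setT f -> (forall x, 0 <= f x)%E ->
  (\int[mu]_(x in D) f x = c%:E * \int[mu]_(x in D) f (c * x)%R)%E.
Proof.
move=> c0 mf f0.
have mc : measurable_fun setT (fun x : Rm => c * x : Rm) by exact: measurable_funM.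
have -> : D = (fun x : Rm => c * x : Rm) @^-1` D.
  apply/seteqP; split => x /=; rewrite !in_itv/= !andbT; by rewrite pmulr_rge0.
have := ge0_integral_pushforward mc mu (measurable_itv `[(0:R), +oo[)
   (measurable_funTS mf) (fun y _ => f0 y).
rewrite /comp => <-.
have -> : (fun x : Rm => c * x : Rm) @^-1` D = D.
  apply/seteqP; split => x /=; rewrite !in_itv/= !andbT; by rewrite pmulr_rge0.
pose nu := measure_function_pushforward__canonical__measure_function_Measure mu mc.
transitivity (\int[mscale (NngNum (ltW c0)) nu]_(x in D) f x)%E; last first.
  rewrite ge0_integral_mscale//; exact: measurable_funTS.
apply: eq_measure_integral => A mA _.
by rewrite /= /mscale -(lebesgue_measure_scale c0 mA).
Qed.

(** [ge0_integral_scale] applies to the positive and negative parts. *)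
Lemma Rintegral_scale (c : R) (f : R -> R) : 0 < c ->
  measurable_fun setT f -> mu.-integrable D (EFin \o (fun x => f (c * x))) ->
  \int[mu]_(x in D) f x = c * \int[mu]_(x in D) f (c * x).
Proof.
move=> c0 mf fi.
have mf' : measurable_fun setT (EFin \o f) by exact/measurable_EFinP.
have mD : measurable (D : set Rm) by exact: measurable_itv.
have fin1 := integrable_pos_fin_num mD fi.
have fin2 := integrable_neg_fin_num mD fi.
rewrite /Rintegral -[c]/(fine c%:E) -fineM//; last exact: integrable_fin_num.
congr fine.
have Ep := ge0_integral_scale c0 (measurable_funepos mf') (funepos_ge0 _).
have En := ge0_integral_scale c0 (measurable_funeneg mf') (funeneg_ge0 _).
have E : (\int[mu]_(x in D) (f (c * x))%:E =
   \int[mu]_(x in D) (EFin \o f)^\+ (c * x)%R -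
   \int[mu]_(x in D) (EFin \o f)^\- (c * x)%R)%E.
  have := integralE mu D ((EFin \o f) \o (fun x : R => c * x)).
  by rewrite funepos_comp funeneg_comp.
rewrite E integralE Ep En.
move: fin1 fin2.
rewrite -[EFin \o _]/((EFin \o f) \o (fun x : R => c * x)) funepos_comp funeneg_comp.
move=> finp finn.
have {}fin1 : (\int[mu]_(x in D) (EFin \o f)^\+ (c * x)%R \is a fin_num)%E := finp.
have {}fin2 : (\int[mu]_(x in D) (EFin \o f)^\- (c * x)%R \is a fin_num)%E := finn.
apply/esym; apply: muleBr => //; exact: fin_num_adde_defr.
Qed.

Definition sinc_pow (d : nat) (v : R) : R := sinc (v / Num.sqrt d%:R) ^+ d.

Definition section_integral (d : nat) (t : R) : R :=
  \int[mu]_(v in D) (sinc_pow d v * cos (2 * t * v)).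

Lemma integrable_sinc_kernel_scale m s (c : R) : 0 < c ->
  mu.-integrable D (EFin \o (fun v => sinc_kernel m.+2 s (c * v))).
Proof.
move=> c0; apply: (@lorentz_integrable _ _ (5 * (1 + c ^- 2))).
  apply: (measurableT_comp (measurable_sinc_kernel _ _)); exact: measurable_funM.
move=> v v0; apply: (le_trans (sinc_kernel_le _ _ _)).
have o1 : 0 < oneDsqr (c * v) by exact: lt_le_trans (oneDsqr_ge1 _).
have o2 : 0 < oneDsqr v by exact: lt_le_trans (oneDsqr_ge1 _).
rewrite -mulrA ler_wpM2l// ler_pdivlMr// mulrC ler_pdivrMr// /oneDsqr.
have -> : (1 + c ^- 2) * (1 + (c * v) ^+ 2) = 1 + v ^+ 2 + (c ^- 2 + (c * v) ^+ 2).
  by field; exact: lt0r_neq0.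
by rewrite lerDl addr_ge0 ?sqr_ge0// invr_ge0 sqr_ge0.
Qed.

Lemma sinc_kernel_scale d (s t v : R) : `|s| = Num.sqrt d.+1%:R * t ->
  sinc_kernel d.+1 s (2 / Num.sqrt d.+1%:R * v) =
  sinc_pow d.+1 v * cos (2 * t * v).
Proof.
move=> st; set r : R := Num.sqrt _ in st *.
have r0 : 0 < r by rewrite sqrtr_gt0.
rewrite /sinc_kernel /sinc_pow -/r; congr (sinc _ ^+ _ * _).
  by field; exact: lt0r_neq0.
have -> : t = `|s| / r by rewrite st mulrC mulKf ?gt_eqF.
have -> : 2 / r * v * s = (2 * v / r) * s by field; exact: lt0r_neq0.
have -> : 2 * (`|s| / r) * v = (2 * v / r) * `|s| by field; exact: lt0r_neq0.
by case: (ger0P s) => _ //; rewrite mulrN cosN.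
Qed.

Lemma integrable_sinc_pow_cos m (t : R) : 0 <= t ->
  mu.-integrable D (EFin \o (fun v => sinc_pow m.+2 v * cos (2 * t * v))).
Proof.
move=> t0; have r0 : 0 < Num.sqrt m.+2%:R :> R by rewrite sqrtr_gt0.
have st : `|Num.sqrt m.+2%:R * t| = Num.sqrt m.+2%:R * t.
  by rewrite ger0_norm// mulr_ge0// ltW.
have c0 : 0 < 2 / Num.sqrt m.+2%:R :> R by rewrite divr_gt0.
rewrite (_ : (fun v => _) =
    fun v => sinc_kernel m.+2 (Num.sqrt m.+2%:R * t) (2 / Num.sqrt m.+2%:R * v)).
  exact: integrable_sinc_kernel_scale.
by apply/funext => v; rewrite (sinc_kernel_scale _ st).
Qed.

(** The substitution [u = 2 * v / sqrt d].  The sign of [s] is lost because the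
    cosine is even. *)
Lemma sinc_integral_scale m (s t : R) : `|s| = Num.sqrt m.+2%:R * t ->
  Num.sqrt m.+2%:R * sinc_integral m.+2 s = 2 * section_integral m.+2 t.
Proof.
move=> st; have r0 : 0 < Num.sqrt m.+2%:R :> R by rewrite sqrtr_gt0.
have c0 : 0 < 2 / Num.sqrt m.+2%:R :> R by rewrite divr_gt0.
rewrite /sinc_integral (Rintegral_scale c0); last 2 first.
- exact: measurable_sinc_kernel.
- exact: integrable_sinc_kernel_scale.
rewrite /section_integral mulrA [Num.sqrt _ * _]mulrC divfK ?gt_eqF//.
by congr (_ * _); apply: eq_Rintegral => v _; rewrite (sinc_kernel_scale _ st).
Qed.

Theorem section_volume_integral m (t v : R) :
  diagonal_section_volume m.+2 t v -> v = 2 / pi * section_integral m.+2 t.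
Proof.
move=> /diagonal_section_volumeE[a [s [a1 st ->]]].
rewrite (lebesgue_cube_slice _ a1) /= mulrA (sinc_integral_scale st).
by rewrite mulrAC.
Qed.

End Scaling.

(** * Gaussian moments *)

Section GaussMoments.
Context {R : realType}.
Local Notation mu := (@lebesgue_measure R).
Local Notation D := (`[(0:R), +oo[%classic).

(** The Gaussian weight of variance 3, which is the pointwise limit of [sinc_pow d]
    away from 0 as [d] grows. *)
Definition gauss6 (v : R) := expR (- (v ^+ 2 / 6)).

Lemma oneDsqr_pow_gauss_bounded m : exists2 C : R, 0 <= C & forall v : R,
  oneDsqr v ^+ m * expR (- (v ^+ 2 / 12)) <= C * (oneDsqr v)^-1.
Proof.
exists (expR (12^-1) * (m.+1`!%:R * 12 ^+ m.+1)).
  by rewrite !mulr_ge0 ?expR_ge0// exprn_ge0.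
move=> v; have o0 : 0 < oneDsqr v by exact: lt_le_trans (oneDsqr_ge1 _).
have x0 : 0 < oneDsqr v / 12 by rewrite divr_gt0.
have E := expRN_le m x0.
rewrite ler_pdivlMr// mulrAC -exprSr.
(* completing [v^2] to [1 + v^2] makes the exponential bound a bound by a negative
   power of [1 + v^2] *)
have -> : expR (- (v ^+ 2 / 12)) = expR (12^-1) * expR (- (oneDsqr v / 12)).
  by rewrite -expRD /oneDsqr; congr expR; field.
rewrite mulrCA ler_wpM2l ?expR_ge0//.
apply: le_trans (ler_wpM2l _ E) _; first by rewrite exprn_ge0// ltW.
rewrite expr_div_n invf_div mulrCA ler_wpM2l// mulrCA mulfV ?mulr1//. 
Qed.

Lemma pow_le_oneDsqr m (v : R) : 0 <= v -> v ^+ m <= oneDsqr v ^+ m.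
Proof.
move=> v0; rewrite lerXn2r ?nnegrE//.
by have := sqr_ge0 (v - 1); rewrite /oneDsqr sqrrB1 -mulr_natl; lra.
Qed.

Lemma pow_gauss_bounded m : exists2 C : R, 0 <= C & forall v : R, 0 <= v ->
  v ^+ m * expR (- (v ^+ 2 / 12)) <= C * (oneDsqr v)^-1.
Proof.
have [C C0 H] := oneDsqr_pow_gauss_bounded m; exists C => // v v0.
by apply: le_trans (H v); rewrite ler_wpM2r ?expR_ge0// pow_le_oneDsqr.
Qed.

Lemma gauss6_le12 (v : R) : gauss6 v <= expR (- (v ^+ 2 / 12)).
Proof.
rewrite /gauss6 ler_expR lerN2 ler_wpM2l ?sqr_ge0// lef_pV2 ?posrE//; lra.
Qed.

Lemma pow_gauss6_bounded m : exists2 C : R, 0 <= C & forall v : R, 0 <= v ->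
  v ^+ m * gauss6 v <= C * (oneDsqr v)^-1.
Proof.
have [C C0 H] := pow_gauss_bounded m; exists C => // v v0.
by apply: le_trans (H v v0); rewrite ler_wpM2l ?exprn_ge0// gauss6_le12.
Qed.

Lemma is_derive_gauss6 (v : R) : is_derive v 1 gauss6 (- (v / 3) * gauss6 v).
Proof. by rewrite /gauss6; apply: is_derive_eq; rewrite /GRing.scale/=; field. Qed.

Lemma continuous_pow_gauss m (g : R -> R) : continuous g ->
  continuous (fun v : R => v ^+ m * gauss6 v * g v).
Proof.
move=> cg v; apply: cvgM; last exact: cg.
apply: cvgM; first exact: exprn_continuous.
exact: (is_derive_continuous is_derive_gauss6).
Qed.

Lemma pow_gauss_lorentz m (g : R -> R) : (forall v, `|g v| <= 1) ->
  exists2 C : R, 0 <= C & forall v : R, 0 <= v ->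
  `|v ^+ m * gauss6 v * g v| <= C * (oneDsqr v)^-1.
Proof.
move=> g1; have [C C0 H] := pow_gauss6_bounded m; exists C => // v v0.
apply: le_trans (H v v0).
by rewrite !normrM normrX (ger0_norm v0) (ger0_norm (expR_ge0 _)) ler_piMr ?mulr_ge0 ?exprn_ge0 ?expR_ge0.
Qed.

Definition gauss_cos m s (v : R) : R := v ^+ m * gauss6 v * cos (s * v).
Definition gauss_sin m s (v : R) : R := v ^+ m * gauss6 v * sin (s * v).
Definition cos_moment m s : R := \int[mu]_(v in D) gauss_cos m s v.
Definition sin_moment m s : R := \int[mu]_(v in D) gauss_sin m s v.

Lemma continuous_gauss_cos m s : continuous (gauss_cos m s).
Proof.
apply: continuous_pow_gauss.
apply: (@is_derive_continuous _ _ (fun v => - s * sin (s * v))) => v.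
by apply: is_derive_eq; rewrite /GRing.scale/=; ring.
Qed.

Lemma continuous_gauss_sin m s : continuous (gauss_sin m s).
Proof.
apply: continuous_pow_gauss.
apply: (@is_derive_continuous _ _ (fun v => s * cos (s * v))) => v.
by apply: is_derive_eq; rewrite /GRing.scale/=; ring.
Qed.

Lemma gauss_cos_bounded m s : exists2 C : R, 0 <= C & forall v : R, 0 <= v ->
  `|gauss_cos m s v| <= C * (oneDsqr v)^-1.
Proof. by apply: pow_gauss_lorentz => v; exact: cos_max. Qed.

Lemma gauss_sin_bounded m s : exists2 C : R, 0 <= C & forall v : R, 0 <= v ->
  `|gauss_sin m s v| <= C * (oneDsqr v)^-1.
Proof. by apply: pow_gauss_lorentz => v; exact: sin_max. Qed.

Lemma integrable_gauss_cos m s : mu.-integrable D (EFin \o gauss_cos m s).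
Proof.
have [C _ H] := gauss_cos_bounded m s.
exact: (lorentz_integrable (continuous_measurable_fun (@continuous_gauss_cos m s)) H).
Qed.

Lemma integrable_gauss_sin m s : mu.-integrable D (EFin \o gauss_sin m s).
Proof.
have [C _ H] := gauss_sin_bounded m s.
exact: (lorentz_integrable (continuous_measurable_fun (@continuous_gauss_sin m s)) H).
Qed.

Lemma lorentz_cvg0 (f : R -> R) (C : R) : 0 <= C ->
  (forall v, 0 <= v -> `|f v| <= C * (oneDsqr v)^-1) ->
  f x @[x --> +oo] --> (0:R).
Proof.
move=> C0 fC; apply: (@cvg_le_inv _ _ C) => x x1.
have x0 : 0 < x by exact: lt_le_trans x1.
apply: le_trans (fC x (ltW x0)) _.
rewrite ler_wpM2l// lef_pV2 ?posrE// ?(lt_le_trans _ (oneDsqr_ge1 _))//.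
rewrite /oneDsqr expr2 -[leLHS]mul1r (le_trans (ler_wpM2r (ltW x0) x1))//.
by rewrite lerDr.
Qed.

Lemma is_derive_pow m (v : R) : is_derive v 1 (fun v : R => v ^+ m.+1) (m.+1%:R * v ^+ m).
Proof.
have -> : (fun v : R => v ^+ m.+1) = (@id R) ^+ m.+1.
  by apply/funext => x; rewrite fctE.
have H := @is_deriveX _ _ (@id R) m v 1 1 _.
by apply: is_derive_eq; rewrite /GRing.scale/= mulr1.
Qed.

Lemma Rintegral_comb (a b : R) (f g : R -> R) :
  mu.-integrable D (EFin \o f) -> mu.-integrable D (EFin \o g) ->
  mu.-integrable D (EFin \o (fun v => a * f v + b * g v)) /\
  \int[mu]_(v in D) (a * f v + b * g v) =
    a * \int[mu]_(v in D) f v + b * \int[mu]_(v in D) g v.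
Proof.
move=> fi gi.
have mD : measurable (D : set (measurableTypeR R)) by exact: measurable_itv.
have afi : mu.-integrable D (EFin \o (fun v => a * f v)) := integrableZl mD a fi.
have bgi : mu.-integrable D (EFin \o (fun v => b * g v)) := integrableZl mD b gi.
split; first exact: (integrableD mD afi bgi).
by rewrite RintegralD// !RintegralZl.
Qed.

Lemma gauss_cos0 m s : gauss_cos m.+1 s 0 = 0.
Proof. by rewrite /gauss_cos expr0n/= !mul0r. Qed.

(** Integration by parts: the derivative of [v ^ (m + 1) * gauss6 v * cos (s * v)]
    integrates to 0. *)
Lemma cos_moment_rec m s : m.+1%:R * cos_moment m s - cos_moment m.+2 s / 3 - s * sin_moment m.+1 s = 0.
Proof.
have dF (v : R) : is_derive v 1 (gauss_cos m.+1 s)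
   (1 * (m.+1%:R * gauss_cos m s v + - 3^-1 * gauss_cos m.+2 s v) + - s * gauss_sin m.+1 s v).
  have dp := is_derive_pow m v; have dg := is_derive_gauss6 v.
  rewrite /gauss_cos /gauss_sin; apply: is_derive_eq; rewrite /GRing.scale/= !exprS.
  by field.
have [i1 E1] := Rintegral_comb m.+1%:R (- 3^-1) (integrable_gauss_cos m s) (integrable_gauss_cos m.+2 s).
have [_ E2] := Rintegral_comb 1 (- s) i1 (integrable_gauss_sin m.+1 s).
have [C1 _ B1] := gauss_cos_bounded m s; have [C2 _ B2] := gauss_cos_bounded m.+2 s.
have [C3 _ B3] := gauss_sin_bounded m.+1 s; have [C4 C40 B4] := gauss_cos_bounded m.+1 s.
have := @Rintegral_FTC2y _ _ _ (m.+1%:R * C1 + 3^-1 * C2 + `|s| * C3) 0 dF.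
rewrite E2 E1 gauss_cos0 subr0 mul1r => <-; first by rewrite /cos_moment /sin_moment; ring.
- move=> v; apply: cvgD; apply: cvgMl_tmp; last exact: continuous_gauss_sin.
  by apply: cvgD; apply: cvgMl_tmp; exact: continuous_gauss_cos.
- move=> v v0; rewrite mul1r (le_trans (ler_normD _ _))// !mulrDl lerD//.
    rewrite (le_trans (ler_normD _ _))// lerD// normrM -mulrA ler_pM ?B1 ?B2//.
      by rewrite ger0_norm.
    by rewrite normrN ger0_norm// invr_ge0.
  by rewrite normrM normrN -mulrA ler_wpM2l// B3.
- exact: lorentz_cvg0 C40 B4.
Qed.

Lemma gauss_sin0 m s : gauss_sin m s 0 = 0.
Proof. by rewrite /gauss_sin mulr0 sin0 mulr0. Qed.

Lemma sin_moment_rec0 s : - (sin_moment 1 s / 3) + s * cos_moment 0 s = 0.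
Proof.
have dF (v : R) : is_derive v 1 (gauss_sin 0 s)
   (- 3^-1 * gauss_sin 1 s v + s * gauss_cos 0 s v).
  have dg := is_derive_gauss6 v; rewrite /gauss_cos /gauss_sin.
  under eq_fun do rewrite expr0 mul1r.
  by apply: is_derive_eq; rewrite /GRing.scale/= expr0 expr1; field.
have [_ E1] := Rintegral_comb (- 3^-1) s (integrable_gauss_sin 1 s) (integrable_gauss_cos 0 s).
have [C1 _ B1] := gauss_sin_bounded 1 s; have [C2 _ B2] := gauss_cos_bounded 0 s.
have [C4 C40 B4] := gauss_sin_bounded 0 s.
have := @Rintegral_FTC2y _ _ _ (3^-1 * C1 + `|s| * C2) 0 dF.
rewrite E1 gauss_sin0 subr0 => <-; first by rewrite /cos_moment /sin_moment; ring.
- move=> v; apply: cvgD; apply: cvgMl_tmp; [exact: continuous_gauss_sin|exact: continuous_gauss_cos].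
- move=> v v0; rewrite (le_trans (ler_normD _ _))// !mulrDl lerD//.
    by rewrite -mulrA normrM normrN (@ger0_norm _ 3^-1) ?invr_ge0// ler_wpM2l ?invr_ge0// B1.
  by rewrite normrM -mulrA ler_wpM2l// B2.
- exact: lorentz_cvg0 C40 B4.
Qed.

Lemma sin_moment_rec m s : m.+1%:R * sin_moment m s - sin_moment m.+2 s / 3 + s * cos_moment m.+1 s = 0.
Proof.
have dF (v : R) : is_derive v 1 (gauss_sin m.+1 s)
   (1 * (m.+1%:R * gauss_sin m s v + - 3^-1 * gauss_sin m.+2 s v) + s * gauss_cos m.+1 s v).
  have dp := is_derive_pow m v; have dg := is_derive_gauss6 v.
  rewrite /gauss_cos /gauss_sin; apply: is_derive_eq; rewrite /GRing.scale/= !exprS.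
  by field.
have [i1 E1] := Rintegral_comb m.+1%:R (- 3^-1) (integrable_gauss_sin m s) (integrable_gauss_sin m.+2 s).
have [_ E2] := Rintegral_comb 1 s i1 (integrable_gauss_cos m.+1 s).
have [C1 _ B1] := gauss_sin_bounded m s; have [C2 _ B2] := gauss_sin_bounded m.+2 s.
have [C3 _ B3] := gauss_cos_bounded m.+1 s; have [C4 C40 B4] := gauss_sin_bounded m.+1 s.
have := @Rintegral_FTC2y _ _ _ (m.+1%:R * C1 + 3^-1 * C2 + `|s| * C3) 0 dF.
rewrite E2 E1 gauss_sin0 subr0 mul1r => <-; first by rewrite /cos_moment /sin_moment; ring.
- move=> v; apply: cvgD; apply: cvgMl_tmp; last exact: continuous_gauss_cos.
  by apply: cvgD; apply: cvgMl_tmp; exact: continuous_gauss_sin.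
- move=> v v0; rewrite mul1r (le_trans (ler_normD _ _))// !mulrDl lerD//.
    rewrite (le_trans (ler_normD _ _))// lerD// normrM -mulrA ler_pM ?B1 ?B2//.
      by rewrite ger0_norm.
    by rewrite normrN ger0_norm// invr_ge0.
  by rewrite normrM -mulrA ler_wpM2l// B3.
- exact: lorentz_cvg0 C40 B4.
Qed.

Lemma cos_moment4 s : cos_moment 4 s = (27 - 162 * s ^+ 2 + 81 * s ^+ 4) * cos_moment 0 s.
Proof.
have := sin_moment_rec0 s; have := cos_moment_rec 0 s; have := sin_moment_rec 1 s; have := cos_moment_rec 2 s.
move=> E4 E3 E2 E1.
have S1 : sin_moment 1 s = 3 * s * cos_moment 0 s by lra.
have C2 : cos_moment 2 s = 3 * cos_moment 0 s - 3 * s * sin_moment 1 s by lra.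
have S3 : sin_moment 3 s = 6 * sin_moment 1 s + 3 * s * cos_moment 2 s by lra.
have C4 : cos_moment 4 s = 9 * cos_moment 2 s - 3 * s * sin_moment 3 s by lra.
by rewrite C4 S3 C2 S1; ring.
Qed.

Lemma cos_taylor2 (x y : R) : `|cos (x + y) - cos x + y * sin x| <= y ^+ 2 / 2.
Proof.
wlog y0 : x y / 0 <= y => [H|].
  have [|y0] := leP 0 y; first exact: H.
  have := H (- x) (- y); rewrite oppr_ge0 => /(_ (ltW y0)).
  by rewrite -opprD !cosN sinN mulrNN sqrrN.
have d1 (z : R) : is_derive z 1 (fun z => z + sin (x + z) - sin x) (1 + cos (x + z)).
  by apply: is_derive_eq; rewrite /GRing.scale/=; ring.
have d2 (z : R) : is_derive z 1 (fun z => z - sin (x + z) + sin x) (1 - cos (x + z)).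
  by apply: is_derive_eq; rewrite /GRing.scale/=; ring.
have d3 (z : R) : is_derive z 1 (fun z => z ^+ 2 / 2 - (cos (x + z) - cos x + z * sin x))
    (z + sin (x + z) - sin x).
  by apply: is_derive_eq; rewrite /GRing.scale/=; field.
have d4 (z : R) : is_derive z 1 (fun z => z ^+ 2 / 2 + (cos (x + z) - cos x + z * sin x))
    (z - sin (x + z) + sin x).
  by apply: is_derive_eq; rewrite /GRing.scale/=; field.
have p1 z : 0 <= z -> 0 <= z + sin (x + z) - sin x.
  move=> z0; have := le_at0_of_derive_ge0 d1 (fun w _ => _) z0.
  by rewrite !addr0 add0r subrr; apply => w; have := cos_geN1 (x + w); lra.
have p2 z : 0 <= z -> 0 <= z - sin (x + z) + sin x.
  move=> z0; have := le_at0_of_derive_ge0 d2 (fun w _ => _) z0.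
  by rewrite !addr0 add0r addNr; apply => w; have := cos_le1 (x + w); lra.
have := le_at0_of_derive_ge0 d3 p1 y0; have := le_at0_of_derive_ge0 d4 p2 y0.
rewrite (_ : 0 ^+ 2 / 2 + _ = 0); last by rewrite addr0; field.
rewrite (_ : 0 ^+ 2 / 2 - _ = 0); last by rewrite addr0; field.
by rewrite ler_norml; lra.
Qed.

End GaussMoments.

Section GaussFourier.
Context {R : realType}.
Local Notation mu := (@lebesgue_measure R).
Local Notation D := (`[(0:R), +oo[%classic).

Lemma measurable_halfline : measurable (D : set (measurableTypeR R)).
Proof. exact: measurable_itv. Qed.
Local Notation mD := measurable_halfline.

Lemma cos_moment00 : cos_moment 0 0 = Num.sqrt (6 * pi) / 2 :> R.
Proof.
have s6 : 0 < Num.sqrt 6 :> R by rewrite sqrtr_gt0.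
have E (x : R) : gauss_cos 0 0 (Num.sqrt 6 * x) = gauss_fun x.
  rewrite /gauss_cos /gauss6 /gauss_fun expr0 mul1r mul0r cos0 mulr1; congr (expR (- _)).
  by rewrite exprMn sqr_sqrtr// mulrAC mulfV ?mul1r.
rewrite /cos_moment /Rintegral (@ge0_integral_scale _ (Num.sqrt 6))//.
- under eq_integral do rewrite E.
  by rewrite integral0y_gauss -EFinM /= sqrtrM// mulrA.
- by apply/measurable_EFinP; apply: continuous_measurable_fun; exact: continuous_gauss_cos.
- by move=> x; rewrite lee_fin /gauss_cos mul0r cos0 mulr1 expr0 mul1r expR_ge0.
Qed.

(** This justifies differentiation under the integral sign. *)
Lemma cos_moment0_taylor (s h : R) :
  `|cos_moment 0 (s + h) - cos_moment 0 s + h * sin_moment 1 s| <= h ^+ 2 / 2 * cos_moment 2 0.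
Proof.
have [i1 E1] := Rintegral_comb 1 (-1) (integrable_gauss_cos 0 (s + h)) (integrable_gauss_cos 0 s).
have [i2 E2] := Rintegral_comb 1 h i1 (integrable_gauss_sin 1 s).
have -> : cos_moment 0 (s + h) - cos_moment 0 s + h * sin_moment 1 s =
  \int[mu]_(v in D) (1 * (1 * gauss_cos 0 (s + h) v + -1 * gauss_cos 0 s v) + h * gauss_sin 1 s v).
  by rewrite E2 E1 /cos_moment /sin_moment; ring.
apply: le_trans (le_normr_Rintegral mD i2) _.
rewrite /cos_moment -RintegralZl//; last exact: integrable_gauss_cos.
apply: le_Rintegral => //.
- exact: integrable_norm i2.
- exact: (integrableZl _ _ (integrable_gauss_cos 2 0)).
move=> v; rewrite /= in_itv/= andbT => v0.
have -> : 1 * (1 * gauss_cos 0 (s + h) v + -1 * gauss_cos 0 s v) + h * gauss_sin 1 s v =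
  gauss6 v * (cos (s * v + h * v) - cos (s * v) + h * v * sin (s * v)).
  by rewrite /gauss_cos /gauss_sin mulrDl; ring.
rewrite normrM ger0_norm ?expR_ge0//.
have -> : h ^+ 2 / 2 * gauss_cos 2 0 v = gauss6 v * ((h * v) ^+ 2 / 2).
  by rewrite /gauss_cos mul0r cos0 exprMn; ring.
by rewrite ler_wpM2l ?expR_ge0// cos_taylor2.
Qed.

Lemma is_derive_quadratic (f : R -> R) (x d C : R) :
  (forall h, `|f (x + h) - f x - h * d| <= h ^+ 2 * C) -> is_derive x 1 f d.
Proof.
move=> H.
suff L : h^-1 *: (f (h *: 1 + x) - f x) @[h --> 0^'] --> d.
  by apply: DeriveDef; [apply/cvg_ex; exists d | exact: cvg_lim L].
apply/cvgrPdist_le => e e0; near=> h.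
have h0 : h != 0 by near: h; exact: nbhs_dnbhs_neq.
have K0 : 0 < `|C| + 1 by rewrite ltr_wpDl.
have he : `|h| <= e / (`|C| + 1).
  near: h; apply: dnbhs0_le; by rewrite divr_gt0.
have -> : d - h^-1 *: (f (h *: 1 + x) - f x) = - (h^-1 * (f (x + h) - f x - h * d)).
  by rewrite /GRing.scale/= mulr1 [h + x]addrC; field.
rewrite normrN normrM normfV ler_pdivrMl ?normr_gt0//.
apply: le_trans (H h) _.
rewrite -(real_normK (num_real h)) expr2 -mulrA ler_wpM2l//.
move: he; rewrite ler_pdivlMr//; apply: le_trans.
by rewrite ler_wpM2l// (le_trans (ler_norm _))// lerDl.
Unshelve. all: end_near. Qed.

Lemma is_derive_cos_moment0 (s : R) : is_derive s 1 (cos_moment 0) (- (3 * s * cos_moment 0 s)).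
Proof.
have -> : - (3 * s * cos_moment 0 s) = - sin_moment 1 s.
  by have := sin_moment_rec0 s; lra.
apply: (@is_derive_quadratic _ _ _ (cos_moment 2 0 / 2)) => h.
have -> : h ^+ 2 * (cos_moment 2 0 / 2) = h ^+ 2 / 2 * cos_moment 2 0 :> R by ring.
by rewrite mulrN opprK cos_moment0_taylor.
Qed.

(** [cos_moment 0] solves the equation [F' = - 3 * s * F], with the Gauss integral as
    initial value. *)
Lemma cos_moment0E (s : R) : cos_moment 0 s = Num.sqrt (6 * pi) / 2 * expR (- (3 / 2 * s ^+ 2)).
Proof.
have dH (x : R) : is_derive x 1 (fun x => cos_moment 0 x * expR (3 / 2 * x ^+ 2)) 0.
  have dG := is_derive_cos_moment0 x.
  by apply: is_derive_eq; rewrite /GRing.scale/=; field.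
have := is_derive_0_is_cst s 0 dH.
rewrite expr0n mulr0 expR0 mulr1 cos_moment00 => <-.
by rewrite -[RHS]mulrA -expRD subrr expR0 mulr1.
Qed.

Lemma cos_moment4E (t : R) : cos_moment 4 (2 * t) =
  27 * (1 - 24 * t ^+ 2 + 48 * t ^+ 4) * (Num.sqrt (6 * pi) / 2) / expR (6 * t ^+ 2).
Proof.
rewrite cos_moment4 cos_moment0E -expRN.
have -> : - (3 / 2 * (2 * t) ^+ 2) = - (6 * t ^+ 2) by field.
by ring.
Qed.

End GaussFourier.

(** * Taylor bounds *)

Section Taylor.
Context {R : realType}.
Implicit Types w q z : R.

Lemma ge0_of_derive (f df : R -> R) : (forall x : R, is_derive x 1 f (df x)) ->
  f 0 = 0 -> (forall x : R, 0 <= x -> 0 <= df x) -> forall x : R, 0 <= x -> 0 <= f x.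
Proof. move=> fd f0 df0 x x0; have := le_at0_of_derive_ge0 fd df0 x0; by rewrite f0. Qed.

(** Each inequality on [sin] or [cos] yields the next one by integration from 0. *)
Lemma sin_taylor w : 0 <= w ->
  [/\ sin w >= w - w ^+ 3 / 6 + w ^+ 5 / 120 - w ^+ 7 / (7 * 72 * 10),
      sin w <= w - w ^+ 3 / 6 + w ^+ 5 / 120 - w ^+ 7 / (7 * 72 * 10) + w ^+ 9 / (72 * 70 * 72) &
      sin w <= w - w ^+ 3 / 6 + w ^+ 5 / 120 /\ sin w >= w - w ^+ 3 / 6].
Proof.
have zero : sin (0 : R) = 0 /\ cos (0 : R) = 1 by rewrite sin0 cos0.
have [s0 c0] := zero.
have A1 : forall x : R, 0 <= x -> 0 <= x - sin x.
  by move=> x x0; rewrite subr_ge0 sin_le.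
have A2 : forall x : R, 0 <= x -> 0 <= cos x - (1 - x ^+ 2 / 2).
  apply: (ge0_of_derive _ _ A1); last by rewrite c0; field.
  by move=> x; apply: is_derive_eq; rewrite /GRing.scale/=; field.
have A3 : forall x : R, 0 <= x -> 0 <= sin x - (x - x ^+ 3 / 6).
  apply: (ge0_of_derive _ _ A2); last by rewrite s0; field.
  by move=> x; apply: is_derive_eq; rewrite /GRing.scale/=; field.
have A4 : forall x : R, 0 <= x -> 0 <= 1 - x ^+ 2 / 2 + x ^+ 4 / 24 - cos x.
  apply: (ge0_of_derive _ _ A3); last by rewrite c0; field.
  by move=> x; apply: is_derive_eq; rewrite /GRing.scale/=; field.
have A5 : forall x : R, 0 <= x -> 0 <= x - x ^+ 3 / 6 + x ^+ 5 / 120 - sin x.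
  apply: (ge0_of_derive _ _ A4); last by rewrite s0; field.
  by move=> x; apply: is_derive_eq; rewrite /GRing.scale/=; field.
have A6 : forall x : R, 0 <= x -> 0 <= cos x - (1 - x ^+ 2 / 2 + x ^+ 4 / 24 - x ^+ 6 / (72 * 10)).
  apply: (ge0_of_derive _ _ A5); last by rewrite c0; field.
  by move=> x; apply: is_derive_eq; rewrite /GRing.scale/=; field.
have A7 : forall x : R, 0 <= x -> 0 <= sin x - (x - x ^+ 3 / 6 + x ^+ 5 / 120 - x ^+ 7 / (7 * 72 * 10)).
  apply: (ge0_of_derive _ _ A6); last by rewrite s0; field.
  by move=> x; apply: is_derive_eq; rewrite /GRing.scale/=; field.
have A8 : forall x : R, 0 <= x -> 0 <= 1 - x ^+ 2 / 2 + x ^+ 4 / 24 - x ^+ 6 / (72 * 10) + x ^+ 8 / (56 * 72 * 10) - cos x.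
  apply: (ge0_of_derive _ _ A7); last by rewrite c0; field.
  by move=> x; apply: is_derive_eq; rewrite /GRing.scale/=; field.
have A9 : forall x : R, 0 <= x -> 0 <= x - x ^+ 3 / 6 + x ^+ 5 / 120 - x ^+ 7 / (7 * 72 * 10) + x ^+ 9 / (72 * 70 * 72) - sin x.
  apply: (ge0_of_derive _ _ A8); last by rewrite s0; field.
  by move=> x; apply: is_derive_eq; rewrite /GRing.scale/=; field.
move=> w0; have := A3 _ w0; have := A5 _ w0; have := A7 _ w0; have := A9 _ w0.
rewrite !subr_ge0 => ? ? ? ?; by [].
Qed.

Lemma expRN_taylor z : 0 <= z ->
  [/\ expR (- z) <= 1 - z + z ^+ 2 / 2,
      1 - z + z ^+ 2 / 2 - z ^+ 3 / 6 <= expR (- z) &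
      expR (- z) <= 1 - z + z ^+ 2 / 2 - z ^+ 3 / 6 + z ^+ 4 / 24].
Proof.
have e0 : expR (- (0 : R)) = 1 by rewrite oppr0 expR0.
have A2 : forall x : R, 0 <= x -> 0 <= expR (- x) - (1 - x).
  by move=> x _; have := expR_ge1Dx (- x); lra.
have A3 : forall x : R, 0 <= x -> 0 <= 1 - x + x ^+ 2 / 2 - expR (- x).
  apply: (ge0_of_derive _ _ A2); last by rewrite e0; field.
  by move=> x; apply: is_derive_eq; rewrite /GRing.scale/=; field.
have A4 : forall x : R, 0 <= x -> 0 <= expR (- x) - (1 - x + x ^+ 2 / 2 - x ^+ 3 / 6).
  apply: (ge0_of_derive _ _ A3); last by rewrite e0; field.
  by move=> x; apply: is_derive_eq; rewrite /GRing.scale/=; field.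
have A5 : forall x : R, 0 <= x -> 0 <= 1 - x + x ^+ 2 / 2 - x ^+ 3 / 6 + x ^+ 4 / 24 - expR (- x).
  apply: (ge0_of_derive _ _ A4); last by rewrite e0; field.
  by move=> x; apply: is_derive_eq; rewrite /GRing.scale/=; field.
move=> z0; have := A3 _ z0; have := A4 _ z0; have := A5 _ z0.
by rewrite !subr_ge0.
Qed.

End Taylor.

Section Pointwise.
Context {R : realType}.
Implicit Types w q z v : R.

Lemma sinc_taylor w : 0 < w -> let q := w ^+ 2 in
  [/\ 1 - q / 6 + q ^+ 2 / 120 - q ^+ 3 / (7 * 72 * 10) <= sinc w,
      sinc w <= 1 - q / 6 + q ^+ 2 / 120 - q ^+ 3 / (7 * 72 * 10)
         + q ^+ 4 / (72 * 70 * 72),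
      sinc w <= 1 - q / 6 + q ^+ 2 / 120 & 1 - q / 6 <= sinc w].
Proof.
move=> w0 q; have [A B [C E]] := sin_taylor (ltW w0).
rewrite /sinc; split; rewrite ?ler_pdivlMr ?ler_pdivrMr// /q.
- by apply: le_trans A; rewrite le_eqVlt; apply/orP; left; apply/eqP; field.
- by apply: le_trans B _; rewrite le_eqVlt; apply/orP; left; apply/eqP; field.
- by apply: le_trans C _; rewrite le_eqVlt; apply/orP; left; apply/eqP; field.
- by apply: le_trans E; rewrite le_eqVlt; apply/orP; left; apply/eqP; field.
Qed.

(** Up to order 2 in [q = w^2] the right-hand side exceeds [sinc w] by [q^2 / 180],
    which dominates the next term [q^3 / 1296] for [q <= 4]. *)
Lemma sinc_le_expR w : 0 < w -> w ^+ 2 <= 4 -> 0 <= sinc w <= expR (- (w ^+ 2 / 6)).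
Proof.
move=> w0 w4; have [_ _ + +] := sinc_taylor w0.
have q0 : 0 <= w ^+ 2 by exact: sqr_ge0.
move: (w ^+ 2) w4 q0 => q q4 q0 A B.
rewrite (le_trans _ B)/=; last by lra.
apply: le_trans A _.
have z0 : 0 <= q / 6 by rewrite divr_ge0.
have [_ + _] := expRN_taylor z0; apply: le_trans.
have : 0 <= q ^+ 2 * (4 - q) by rewrite mulr_ge0 ?sqr_ge0// subr_ge0.
have : 0 <= q ^+ 2 by exact: sqr_ge0.
have -> : 1 - q / 6 + (q / 6) ^+ 2 / 2 - (q / 6) ^+ 3 / 6 =
  1 - q / 6 + q ^+ 2 * (72^-1 - q / (36 * 36)) by field.
have -> : q ^+ 2 * (4 - q) = 4 * q ^+ 2 - q ^+ 2 * q by ring.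
have -> : q ^+ 2 * (72^-1 - q / (36 * 36)) = q ^+ 2 / 72 - (q ^+ 2 * q) / (36 * 36) by ring.
move: (q ^+ 2 * q) (q ^+ 2) => a b; lra.
Qed.

(** Taylor polynomial of [- ln (sinc w)] at order 3 in [q = w^2]; the last
    denominator is 2835. *)
Definition sinc_phase q := q / 6 + q ^+ 2 / 180 + q ^+ 3 / (81 * 35).

Lemma sinc_expR_dist w : 0 < w -> w ^+ 2 <= 4 ->
  `|sinc w - expR (- sinc_phase (w ^+ 2))| <= (w ^+ 2) ^+ 4.
Proof.
move=> w0 w4; have [A B _ _] := sinc_taylor w0.
have q0 : 0 <= w ^+ 2 by exact: sqr_ge0.
move: (w ^+ 2) w4 q0 A B => q q4 q0 A B.
have z0 : 0 <= sinc_phase q.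
  by rewrite /sinc_phase !addr_ge0// divr_ge0// ?exprn_ge0.
have zq : sinc_phase q <= q.
  have -> : q = q * 1 by rewrite mulr1.
  rewrite /sinc_phase; have q2 : q ^+ 2 <= q * 4 by rewrite expr2 ler_wpM2l.
  have q3 : q ^+ 3 <= q * 16.
    rewrite exprS ler_wpM2l//; have -> : 16 = 4 ^+ 2 :> R by rewrite -natrX.
    by rewrite lerXn2r ?nnegrE.
  lra.
have z4 : sinc_phase q ^+ 4 <= q ^+ 4 by rewrite lerXn2r ?nnegrE.
have [_ C E] := expRN_taylor z0.
set P := 1 - q / 6 + q ^+ 2 / 120 - q ^+ 3 / (7 * 72 * 10) in A B.
set Q := 1 - sinc_phase q + sinc_phase q ^+ 2 / 2 - sinc_phase q ^+ 3 / 6 in C E.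
suff PQ : `|P - Q| <= q ^+ 4 / 2.
  have q40 : 0 <= q ^+ 4 by exact: exprn_ge0.
  by move: PQ; rewrite !ler_norml => /andP[? ?]; apply/andP; split; lra.
(* [sinc_phase q = q / 6 + q^2 * s], and the Taylor polynomials of the two sides,
   written with [s], differ by a multiple of [q^4] *)
pose s := 180^-1 + q / (81 * 35).
have s0 : 0 <= s by rewrite /s; lra.
have s1 : s <= 100^-1 by rewrite /s; lra.
have -> : P - Q = q ^+ 4 * (s / 72 + q * s ^+ 2 / 12 + q ^+ 2 * s ^+ 3 / 6
    - (6 * (81 * 35))^-1 - s ^+ 2 / 2).
  by rewrite /P /Q /sinc_phase /s; field.
rewrite normrM ger0_norm ?exprn_ge0// ler_wpM2l ?exprn_ge0//.
have s2 : 0 <= s ^+ 2 <= 100^-1.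
  rewrite sqr_ge0/= expr2 (le_trans (ler_wpM2l s0 s1))//; lra.
have s3 : 0 <= s ^+ 3 <= 100^-1.
  rewrite exprn_ge0//= exprS (le_trans (ler_wpM2l s0 (andP s2).2))//; lra.
have qs2 : 0 <= q * s ^+ 2 <= 4 * 100^-1.
  by rewrite mulr_ge0//= ?ler_pM//; case/andP: s2.
have q2 : 0 <= q ^+ 2 <= 16.
  rewrite sqr_ge0/= expr2 (_ : 16 = 4 * 4); last by ring.
  by rewrite ler_pM.
have qs3 : 0 <= q ^+ 2 * s ^+ 3 <= 16 * 100^-1.
  case/andP: q2 => ? ?; case/andP: s3 => ? ?.
  by rewrite mulr_ge0//= ler_pM.
rewrite ler_norml; lra.
Qed.

Lemma exprB_le n (x y M : R) : 0 <= x <= M -> 0 <= y <= M ->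
  `|x ^+ n.+1 - y ^+ n.+1| <= n.+1%:R * `|x - y| * M ^+ n.
Proof.
move=> /andP[x0 xM] /andP[y0 yM]; have M0 : 0 <= M by exact: le_trans xM.
elim: n => [|n IH]; first by rewrite !expr1 mul1r expr0 mulr1.
have -> : x ^+ n.+2 - y ^+ n.+2 = x * (x ^+ n.+1 - y ^+ n.+1) + (x - y) * y ^+ n.+1.
  by rewrite (exprS x n.+1) (exprS y n.+1); ring.
rewrite (le_trans (ler_normD _ _))//.
have -> : n.+2%:R * `|x - y| * M ^+ n.+1 =
    M * (n.+1%:R * `|x - y| * M ^+ n) + `|x - y| * M ^+ n.+1.
  by rewrite exprS -natr1; ring.
rewrite lerD// !normrM.
  by rewrite ler_pM// ger0_norm.
by rewrite ler_wpM2l// ger0_norm ?exprn_ge0// lerXn2r ?nnegrE.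
Qed.

End Pointwise.

(** * Expansion of sinc (v / sqrt d) ^ d in powers of 1 / d *)

Section Expansion.
Context {R : realType}.
Implicit Types (v r : R) (d n : nat).

Let e12 v : R := expR (- (v ^+ 2 / 12)).

(** The expansion of [sinc_pow d v] at order 2 in [r = 1 / d]. *)
Definition sinc_pow_approx (r v : R) : R :=
  gauss6 v * (1 - v ^+ 4 / 180 * r +
    ((v ^+ 4 / 180) ^+ 2 / 2 - v ^+ 6 / (81 * 35)) * r ^+ 2).

Let Q1 v : 1 <= oneDsqr v. Proof. exact: oneDsqr_ge1. Qed.
Let Q0 v : 0 < oneDsqr v. Proof. exact: lt_le_trans (Q1 v). Qed.

Let powQ k m v : 0 <= v -> (k <= m)%N -> v ^+ k <= oneDsqr v ^+ m.
Proof.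
move=> v0 km; apply: le_trans (pow_le_oneDsqr k v0) _.
by rewrite ler_weXn2l.
Qed.

(** Both powers have base at most [exp (- q / 6)] with [q = v^2 / d], so the
    remaining [d - 1] factors leave a Gaussian. *)
Lemma sinc_pow_small n v : 0 < v -> v ^+ 2 <= 4 * n.+2%:R ->
  `|sinc_pow n.+2 v - expR (- sinc_phase (v ^+ 2 / n.+2%:R)) ^+ n.+2| <=
  v ^+ 8 * e12 v / n.+2%:R ^+ 3.
Proof.
move=> v0 v4; have d0 : 0 < n.+2%:R :> R by [].
set d : R := n.+2%:R in d0 v4 *.
have sd0 : 0 < Num.sqrt d by rewrite sqrtr_gt0.
set w := v / Num.sqrt d; have w0 : 0 < w by rewrite divr_gt0.
have wE : w ^+ 2 = v ^+ 2 / d by rewrite expr_div_n sqr_sqrtr// ltW.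
have w4 : w ^+ 2 <= 4 by rewrite wE ler_pdivrMr.
have H1 := sinc_le_expR w0 w4; have H2 := sinc_expR_dist w0 w4.
rewrite wE in H1 H2; set q := v ^+ 2 / d in H1 H2 *.
have q0 : 0 <= q by rewrite divr_ge0 ?sqr_ge0 ?ltW.
have H3 : 0 <= expR (- sinc_phase q) <= expR (- (q / 6)).
  rewrite expR_ge0/= ler_expR lerN2 /sinc_phase -addrA lerDl addr_ge0// divr_ge0// exprn_ge0//.
have := exprB_le n.+1 H1 H3; rewrite -/d => H.
rewrite /sinc_pow -/d -/w; apply: le_trans H _.
have -> : v ^+ 8 * e12 v / d ^+ 3 = d * q ^+ 4 * e12 v.
  by rewrite /q; field; exact: lt0r_neq0.
have P1 : d * `|sinc w - expR (- sinc_phase q)| <= d * q ^+ 4.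
  by rewrite ler_wpM2l// ltW.
suff P2 : expR (- (q / 6)) ^+ n.+1 <= e12 v.
  by apply: ler_pM P1 P2; [rewrite mulr_ge0// ltW|rewrite exprn_ge0// expR_ge0].
rewrite -expRM_natl ler_expR mulrN lerN2 /q.
have -> : v ^+ 2 / 12 = v ^+ 2 / d / 6 * (d / 2) by field; exact: lt0r_neq0.
rewrite [leRHS]mulrC ler_wpM2l//; first by rewrite divr_ge0.
by rewrite ler_pdivrMr// -natrM ler_nat; rewrite muln2 doubleS !ltnS -addnn leq_addr.
Qed.

Lemma phase_expansion r v : 0 <= v -> 0 <= r <= 1 ->
  `|expR (- (v ^+ 4 / 180 * r + v ^+ 6 / (81 * 35) * r ^+ 2)) -
    (1 - v ^+ 4 / 180 * r +
    ((v ^+ 4 / 180) ^+ 2 / 2 - v ^+ 6 / (81 * 35)) * r ^+ 2)| <=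
  10 * oneDsqr v ^+ 18 * r ^+ 3.
Proof.
move=> v0 /andP[r0 r1].
set al := v ^+ 4 / 180; set be := v ^+ 6 / (81 * 35).
have al0 : 0 <= al by rewrite divr_ge0// exprn_ge0.
have be0 : 0 <= be by rewrite divr_ge0// exprn_ge0.
set T := oneDsqr v ^+ 6.
have T0 : 1 <= T by rewrite exprn_ege1.
have alT : al <= T.
  rewrite /al ler_pdivrMr//; apply: le_trans (powQ v0 (_ : 4 <= 6)%N) _ => //.
  by rewrite ler_peMr// ?(le_trans ler01)//; lra.
have beT : be <= T.
  rewrite /be ler_pdivrMr//; apply: le_trans (powQ v0 (_ : 6 <= 6)%N) _ => //.
  by rewrite ler_peMr// ?(le_trans ler01)//; lra.
have TE : oneDsqr v ^+ 18 = T ^+ 3 by rewrite -exprM.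
rewrite TE; clearbody al be T; clear TE.
have z0 : 0 <= al * r + be * r ^+ 2 by rewrite addr_ge0// mulr_ge0// exprn_ge0.
have [A B _] := expRN_taylor z0.
have r30 : 0 <= r ^+ 3 by exact: exprn_ge0.
have zT : al * r + be * r ^+ 2 <= 2 * T * r.
  have -> : 2 * T * r = T * r + T * r by ring.
  apply: lerD; first exact: ler_wpM2r.
  by rewrite expr2 mulrA ler_wpM2r// (le_trans _ beT)// ler_piMr.
have z3 : (al * r + be * r ^+ 2) ^+ 3 <= 8 * T ^+ 3 * r ^+ 3.
  have -> : 8 * T ^+ 3 * r ^+ 3 = (2 * T * r) ^+ 3 by ring.
  rewrite lerXn2r ?nnegrE//; apply: le_trans zT => //.
have T2 : T ^+ 2 <= T ^+ 3 by rewrite ler_weXn2l.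
have ab : al * be <= T ^+ 3.
  by apply: le_trans T2; rewrite expr2 ler_pM.
have bb : be ^+ 2 * r <= T ^+ 3.
  apply: le_trans T2; rewrite -[leRHS]mulr1 ler_pM ?sqr_ge0//.
  by rewrite lerXn2r ?nnegrE// (le_trans ler01).
have ab3 : 0 <= al * be * r ^+ 3 <= T ^+ 3 * r ^+ 3.
  by rewrite !mulr_ge0//= ler_wpM2r.
have bb3 : 0 <= be ^+ 2 * r * r ^+ 3 <= T ^+ 3 * r ^+ 3.
  by rewrite !mulr_ge0 ?sqr_ge0//= ler_wpM2r.
have E : (al * r + be * r ^+ 2) ^+ 2 =
  al ^+ 2 * r ^+ 2 + 2 * (al * be * r ^+ 3) + be ^+ 2 * r * r ^+ 3 by ring.
rewrite E in A B.
rewrite ler_norml; move: A B z3 ab3 bb3 => A B z3 /andP[? ?] /andP[? ?].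
have -> : 1 - al * r + (al ^+ 2 / 2 - be) * r ^+ 2 =
  1 - al * r + (al ^+ 2 * r ^+ 2 / 2 - be * r ^+ 2) by field.
have T3r : 10 * T ^+ 3 * r ^+ 3 = 10 * (T ^+ 3 * r ^+ 3) by ring.
have T3r' : 8 * T ^+ 3 * r ^+ 3 = 8 * (T ^+ 3 * r ^+ 3) by ring.
rewrite T3r; rewrite T3r' in z3; lra.
Qed.

(** The terms of [d * sinc_phase (v^2 / d)] in [d^0], [1 / d] and [1 / d^2]. *)
Lemma sinc_pow_phase n v : expR (- sinc_phase (v ^+ 2 / n.+1%:R)) ^+ n.+1 =
  gauss6 v * expR (- (v ^+ 4 / 180 * n.+1%:R^-1 + v ^+ 6 / (81 * 35) * n.+1%:R^-1 ^+ 2)).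
Proof.
rewrite -expRM_natl /gauss6 -expRD; congr expR; rewrite /sinc_phase.
have : n.+1%:R != 0 :> R by rewrite pnatr_eq0.
by move: (n.+1%:R : R) => d d0; field.
Qed.

(** From [1 / 2 <= exp (- 1 / 2)] and [exp (- x) <= 4! / x^4]. *)
Lemma half_pow_le n : (2^-1 : R) ^+ n.+1 <= 384 / n.+1%:R ^+ 4.
Proof.
have h : (2^-1 : R) <= expR (- 2^-1).
  by have := expR_ge1Dx (- 2^-1 : R); lra.
have x0 : 0 < n.+1%:R / 2 :> R by rewrite divr_gt0.
apply: (@le_trans _ _ (expR (- 2^-1) ^+ n.+1)).
  by rewrite lerXn2r ?nnegrE ?expR_ge0.
rewrite -expRM_natl mulrN; apply: le_trans (expRN_le 3 x0) _.
rewrite le_eqVlt; apply/orP; left; apply/eqP.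
rewrite (_ : 4`! = 24)%N//.
by move: (n.+1%:R : R) x0 => d; rewrite pmulr_lgt0// => /lt0r_neq0 d0; field.
Qed.

(** Two factors are bounded by [1 / w], which gives the decay in [v], and the
    others by [1 / 2], which gives the decay in [d]. *)
Lemma sinc_pow_large n v : 0 < v -> 4 * n.+2%:R < v ^+ 2 ->
  `|sinc_pow n.+2 v| <= 3072 * (oneDsqr v)^-1 / n.+2%:R ^+ 3.
Proof.
move=> v0 v4; have d0 : 0 < n.+2%:R :> R by [].
have d1 : 1 <= n.+2%:R :> R by rewrite ler1n.
have hp := half_pow_le n.+1; rewrite /sinc_pow.
set d : R := n.+2%:R in d0 v4 d1 hp *.
have sd0 : 0 < Num.sqrt d by rewrite sqrtr_gt0.
set w := v / Num.sqrt d; have w0 : 0 < w by rewrite divr_gt0.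
have wE : w ^+ 2 = v ^+ 2 / d by rewrite expr_div_n sqr_sqrtr// ltW.
have w2 : 2 <= w.
  rewrite -ler_sqr ?nnegrE ?(ltW w0)// wE ler_pdivlMr// (_ : 2 ^+ 2 = 4); last by ring.
  exact: ltW.
have s1 : `|sinc w| <= w^-1 by have := norm_sinc_le w; rewrite (gtr0_norm w0).
have s2 : `|sinc w| <= 2^-1.
  by apply: (le_trans s1); rewrite lef_pV2 ?posrE.
rewrite normrX exprSr exprSr -mulrA.
apply: (@le_trans _ _ (2^-1 ^+ n * (w^-1 * w^-1))).
  apply: ler_pM => //; first by rewrite lerXn2r ?nnegrE.
  by rewrite ler_pM.
have -> : w^-1 * w^-1 = d / v ^+ 2.
  by rewrite -invfM -expr2 wE invf_div.
have -> : 2^-1 ^+ n = 4 * 2^-1 ^+ n.+2 :> R by rewrite !exprSr; field.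
apply: (@le_trans _ _ (4 * (384 / d ^+ 4) * (d / v ^+ 2))).
  rewrite ler_wpM2r//; first by rewrite divr_ge0 ?sqr_ge0// ltW.
  by rewrite ler_wpM2l.
have v2 : 0 < v ^+ 2 by rewrite exprn_gt0.
have vQ : (v ^+ 2)^-1 <= 2 * (oneDsqr v)^-1.
  rewrite -[leRHS]invrK lef_pV2 ?posrE ?invr_gt0 ?mulr_gt0 ?invr_gt0//.
  rewrite invfM invrK /oneDsqr; lra.
have -> : 4 * (384 / d ^+ 4) * (d / v ^+ 2) = (4 * 384 * (v ^+ 2)^-1) / d ^+ 3.
  by field; rewrite !lt0r_neq0.
rewrite ler_wpM2r ?invr_ge0 ?exprn_ge0 ?(ltW d0)//.
have -> : 3072 * (oneDsqr v)^-1 = 4 * (384 * (2 * (oneDsqr v)^-1)) by ring.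
rewrite -mulrA.
exact: (ler_wpM2l (ler0n R 4) (ler_wpM2l (ler0n R 384) vQ)).
Qed.

Let e12_ge0 v : 0 <= e12 v. Proof. exact: expR_ge0. Qed.

Lemma sinc_pow_approx_small n v : 0 < v -> v ^+ 2 <= 4 * n.+2%:R ->
  `|sinc_pow n.+2 v - sinc_pow_approx n.+2%:R^-1 v| <=
  11 * (oneDsqr v ^+ 18 * e12 v) / n.+2%:R ^+ 3.
Proof.
move=> v0 v4; have H := sinc_pow_small v0 v4.
rewrite sinc_pow_phase in H.
have d0 : 0 < n.+2%:R :> R by [].
have r01 : 0 <= (n.+2%:R^-1 : R) <= 1 by rewrite invr_ge0 ler0n/= invf_le1// ler1n.
have K := phase_expansion (ltW v0) r01.
set X := expR _ in H K; set r : R := n.+2%:R^-1 in H K r01 *.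
set Y := 1 - _ + _ in K.
have -> : sinc_pow n.+2 v - sinc_pow_approx r v =
  (sinc_pow n.+2 v - gauss6 v * X) + gauss6 v * (X - Y).
  by rewrite /sinc_pow_approx -/Y; ring.
apply: le_trans (ler_normD _ _) _.
have -> : 11 * (oneDsqr v ^+ 18 * e12 v) / n.+2%:R ^+ 3 =
  oneDsqr v ^+ 18 * e12 v / n.+2%:R ^+ 3 + e12 v * (10 * oneDsqr v ^+ 18 * r ^+ 3).
  by rewrite /r exprVn; ring.
apply: lerD.
  apply: le_trans H _; rewrite ler_wpM2r ?invr_ge0 ?exprn_ge0//.
  by rewrite ler_wpM2r// powQ// ltW.
rewrite normrM ger0_norm ?expR_ge0// ler_pM ?expR_ge0//.
exact: gauss6_le12.
Qed.

(** On this range [1 <= v^6 / d^3]. *)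
Lemma sinc_pow_approx_large n v : 0 < v -> 4 * n.+2%:R < v ^+ 2 ->
  `|sinc_pow_approx n.+2%:R^-1 v| <=
  4 * (oneDsqr v ^+ 18 * e12 v) / n.+2%:R ^+ 3.
Proof.
move=> v0 v4; have d0 : 0 < n.+2%:R :> R by [].
have r01 : 0 <= (n.+2%:R^-1 : R) <= 1 by rewrite invr_ge0 ler0n/= invf_le1// ler1n.
have r3 : 1 <= v ^+ 6 * n.+2%:R^-1 ^+ 3.
  rewrite exprVn ler_pdivlMr ?exprn_gt0// mul1r (_ : v ^+ 6 = (v ^+ 2) ^+ 3); last by rewrite -exprM.
  rewrite lerXn2r ?nnegrE ?ler0n ?sqr_ge0//; apply: le_trans (ltW v4).
  by rewrite ler_peMl// ler1n.
rewrite -exprVn; set r : R := n.+2%:R^-1 in r01 r3 *.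
have [r0 r1] := andP r01.
rewrite normrM ger0_norm ?expR_ge0//.
set T := oneDsqr v ^+ 12.
have T1 : 1 <= T by rewrite exprn_ege1.
set al := v ^+ 4 / 180; set be := v ^+ 6 / (81 * 35).
have al0 : 0 <= al by rewrite divr_ge0// exprn_ge0// ltW.
have be0 : 0 <= be by rewrite divr_ge0// exprn_ge0// ltW.
have alT : al <= T.
  rewrite /al ler_pdivrMr//; apply: le_trans (powQ (ltW v0) (_ : 4 <= 12)%N) _ => //.
  by rewrite ler_peMr// ?(le_trans ler01)//; lra.
have al2T : al ^+ 2 <= T.
  rewrite /al expr_div_n ler_pdivrMr// -exprM.
  apply: le_trans (powQ (ltW v0) (_ : 4 * 2 <= 12)%N) _ => //.
  by rewrite ler_peMr// ?(le_trans ler01)//; lra.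
have beT : be <= T.
  rewrite /be ler_pdivrMr//; apply: le_trans (powQ (ltW v0) (_ : 6 <= 12)%N) _ => //.
  by rewrite ler_peMr// ?(le_trans ler01)//; lra.
have r21 : 0 <= r ^+ 2 <= 1 by rewrite exprn_ge0//= exprn_ile1.
have B : `|1 - al * r + (al ^+ 2 / 2 - be) * r ^+ 2| <= 4 * T.
  have A1 : 0 <= al * r <= T by rewrite mulr_ge0//= (le_trans _ alT)// ler_piMr.
  have A2 : 0 <= al ^+ 2 * r ^+ 2 <= T.
    by rewrite mulr_ge0 ?exprn_ge0//= (le_trans _ al2T)// ler_piMr ?exprn_ge0// (andP r21).2.
  have A3 : 0 <= be * r ^+ 2 <= T.
    by rewrite mulr_ge0 ?exprn_ge0//= (le_trans _ beT)// ler_piMr// (andP r21).2.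
  have -> : 1 - al * r + (al ^+ 2 / 2 - be) * r ^+ 2 =
    1 - al * r + (al ^+ 2 * r ^+ 2 / 2 - be * r ^+ 2) by field.
  by rewrite ler_norml; lra.
apply: (@le_trans _ _ (e12 v * (4 * T))).
  by apply: ler_pM B; rewrite ?expR_ge0 ?gauss6_le12.
have -> : 4 * (oneDsqr v ^+ 18 * e12 v) * r ^+ 3 = e12 v * (4 * T) * (oneDsqr v ^+ 6 * r ^+ 3).
  by rewrite /T; ring.
rewrite ler_peMr//; first by rewrite !mulr_ge0// (le_trans ler01).
by apply: le_trans r3 _; rewrite ler_wpM2r ?exprn_ge0// powQ// ltW.
Qed.

(** The bound is [1 / d^3] times a function of [v] that is integrable and common to
    all [d], so the expansion can be integrated. *)
Lemma sinc_pow_expansion : exists C : R, forall n v, 0 < v ->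
  `|sinc_pow n.+2 v - sinc_pow_approx n.+2%:R^-1 v| <=
  C * (oneDsqr v)^-1 / n.+2%:R ^+ 3.
Proof.
have [C C0 HC] := @oneDsqr_pow_gauss_bounded R 18.
exists (11 * C + 3072) => n v v0.
have iQ : 0 <= (oneDsqr v)^-1 by rewrite invr_ge0 ltW.
have [v4|v4] := leP (v ^+ 2) (4 * n.+2%:R).
  apply: le_trans (sinc_pow_approx_small v0 v4) _.
  rewrite ler_wpM2r ?invr_ge0 ?exprn_ge0//.
  by have := HC v; rewrite -/(e12 v) mulrDl; lra.
apply: le_trans (ler_normB _ _) _.
apply: le_trans (lerD (sinc_pow_large v0 v4) (sinc_pow_approx_large v0 v4)) _.
rewrite -mulrDl ler_wpM2r ?invr_ge0 ?exprn_ge0//.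
have := HC v; rewrite -/(e12 v) mulrDl.
have : 0 <= C * (oneDsqr v)^-1 by rewrite mulr_ge0.
lra.
Qed.

End Expansion.

(** * Passing to the limit *)

Section Limit.
Context {R : realType}.
Local Notation mu := (@lebesgue_measure R).
Local Notation D := (`[(0:R), +oo[%classic).
Local Notation P := (`](0:R), +oo[%classic).

(** The bound is asked away from 0 only, where [sinc] has its Taylor expansion. *)
Lemma Rintegral_le_pos (f : R -> R) (K : R) : 0 <= K ->
  mu.-integrable D (EFin \o f) ->
  (forall v, 0 < v -> `|f v| <= K * (oneDsqr v)^-1) ->
  `|\int[mu]_(v in D) f v| <= K * (pi / 2).
Proof.
move=> K0 fi fK.
have mD : measurable (D : set (measurableTypeR R)) by exact: measurable_itv.
have mP : measurable (P : set (measurableTypeR R)) by exact: measurable_itv.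
have PD : P `<=` D by move=> x /=; rewrite !in_itv/= !andbT; exact: ltW.
have fiP : mu.-integrable P (EFin \o f) by exact: (integrableS mD mP PD fi).
have giP : mu.-integrable P (EFin \o (fun v => K * (oneDsqr v)^-1)).
  have giD : mu.-integrable D (EFin \o (fun v => K * (oneDsqr v)^-1)).
    by apply: (integrableZl _ K (@integrable_oneDsqrV R)); exact: measurable_itv.
  exact: (integrableS mD mP PD giD).
rewrite -(Rintegral_itv_obnd_cbnd fiP).
apply: le_trans (le_normr_Rintegral mP fiP) _.
apply: (@le_trans _ _ (\int[mu]_(v in P) (K * (oneDsqr v)^-1))).
  apply: le_Rintegral => //; first exact: integrable_norm fiP.
  by move=> v; rewrite /= in_itv/= andbT; exact: fK.
rewrite (Rintegral_itv_obnd_cbnd giP).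
by rewrite RintegralZl ?Rintegral_oneDsqrV//; exact: integrable_oneDsqrV.
Qed.

Lemma section_integral_expansion (t : R) : 0 <= t ->
  exists c0 c2 K : R, forall n,
  `|section_integral n.+2 t - (c0 - cos_moment 4 (2 * t) / 180 / n.+2%:R + c2 / n.+2%:R ^+ 2)|
  <= K / n.+2%:R ^+ 3.
Proof.
move=> t0; have [C HC] := @sinc_pow_expansion R.
pose s := 2 * t.
have [i1 E1] := Rintegral_comb (180 * 360)^-1 (- (81 * 35)^-1)
  (integrable_gauss_cos 8 s) (integrable_gauss_cos 6 s).
have C0 : 0 <= C.
  have p : 0 < (oneDsqr (1 : R))^-1 / 2%:R ^+ 3.
    by rewrite divr_gt0 ?exprn_gt0// invr_gt0 (lt_le_trans ltr01 (oneDsqr_ge1 _)).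
  have := le_trans (normr_ge0 _) (HC 0 1 ltr01).
  by rewrite -mulrA pmulr_lge0.
exists (cos_moment 0 s), ((180 * 360)^-1 * cos_moment 8 s - (81 * 35)^-1 * cos_moment 6 s), (C * (pi / 2)) => n.
set r : R := n.+2%:R^-1.
have [i2 E2] := Rintegral_comb 1 (- (r / 180)) (integrable_gauss_cos 0 s) (integrable_gauss_cos 4 s).
have [i3 E3] := Rintegral_comb 1 (r ^+ 2) i2 i1.
have [i4 E4] := Rintegral_comb 1 (-1) (integrable_sinc_pow_cos n t0) i3.
have fE v : 1 * (sinc_pow n.+2 v * cos (2 * t * v)) + -1 *
  (1 * (1 * gauss_cos 0 s v + - (r / 180) * gauss_cos 4 s v) + r ^+ 2 *
   ((180 * 360)^-1 * gauss_cos 8 s v + - (81 * 35)^-1 * gauss_cos 6 s v)) =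
  (sinc_pow n.+2 v - sinc_pow_approx r v) * cos (s * v).
  by rewrite /gauss_cos /sinc_pow_approx -/s; field.
have -> : section_integral n.+2 t - (cos_moment 0 s - cos_moment 4 (2 * t) / 180 / n.+2%:R +
   ((180 * 360)^-1 * cos_moment 8 s - (81 * 35)^-1 * cos_moment 6 s) / n.+2%:R ^+ 2) =
  \int[mu]_(v in D) ((sinc_pow n.+2 v - sinc_pow_approx r v) * cos (s * v)).
  transitivity (1 * section_integral n.+2 t + -1 *
    (1 * (1 * cos_moment 0 s + - (r / 180) * cos_moment 4 s) + r ^+ 2 *
     ((180 * 360)^-1 * cos_moment 8 s + - (81 * 35)^-1 * cos_moment 6 s))).
    by rewrite -exprVn -/r -/s; ring.
  by rewrite /cos_moment -E1 -E2 -E3 -E4; apply: eq_Rintegral => v _; exact: fE.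
rewrite mulrAC; apply: Rintegral_le_pos.
- by rewrite divr_ge0// exprn_ge0.
- by move: i4; congr (_.-integrable _ _); apply/funext => v /=; rewrite fE.
- move=> v v0; rewrite normrM.
  apply: (le_trans (ler_piMr _ (cos_max _))) => //.
  by apply: le_trans (HC n v v0) _; rewrite mulrAC.
Qed.

(** [d^2 * (c1 / d - c1 / (d + 1))] tends to [c1], and the other terms contribute
    [O(1 / d)].  The expansion must reach [1 / d^2]: an error of that order would
    not be negligible after multiplication by [d^2]. *)
Lemma cvg_of_expansion (u : nat -> R) (c0 c1 c2 K : R) :
  (forall n, `|u n.+2 - (c0 - c1 / n.+2%:R + c2 / n.+2%:R ^+ 2)| <= K / n.+2%:R ^+ 3) ->
  (fun d : nat => d%:R ^+ 2 * (u d.+1 - u d)) @ \oo --> c1.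
Proof.
move=> H.
pose M := `|c1| + 2 * `|c2| + 2 * K.
have K0 : 0 <= K.
  have := le_trans (normr_ge0 _) (H 0); rewrite pmulr_lge0// invr_gt0 exprn_gt0//.
have HM n : `|n.+2%:R ^+ 2 * (u n.+3 - u n.+2) - c1| <= M / n.+2%:R.
  have d0 : 0 < n.+2%:R :> R by [].
  have := H n; have := H n.+1.
  have -> : n.+3%:R = n.+2%:R + 1 :> R by rewrite natr1.
  move: (n.+2%:R) d0 => d d0; have d1 : 0 < d + 1 by rewrite addr_gt0.
  set e1 := u n.+3 - _; set e0 := u n.+2 - _ => B1 B0.
  have -> : d ^+ 2 * (u n.+3 - u n.+2) - c1 =
    d ^+ 2 * (e1 - e0) - c1 / (d + 1) - c2 * ((2 * d + 1) / (d + 1) ^+ 2).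
    by rewrite /e1 /e0; field; rewrite !lt0r_neq0.
  have B1' : `|e1| <= K / d ^+ 3.
    apply: (le_trans B1); rewrite ler_wpM2l// lef_pV2 ?posrE ?exprn_gt0//.
    by rewrite lerXn2r ?nnegrE ?lerDl// ltW.
  have T1 : `|d ^+ 2 * (e1 - e0)| <= 2 * K / d.
    rewrite normrM ger0_norm ?sqr_ge0//.
    have -> : 2 * K / d = d ^+ 2 * (K / d ^+ 3 + K / d ^+ 3) by field; exact: lt0r_neq0.
    by rewrite ler_wpM2l ?sqr_ge0// (le_trans (ler_normB _ _))// lerD.
  have T2 : `|c1 / (d + 1)| <= `|c1| / d.
    rewrite normrM ler_wpM2l// normfV gtr0_norm// lef_pV2 ?posrE//; lra.
  have T3 : `|c2 * ((2 * d + 1) / (d + 1) ^+ 2)| <= 2 * `|c2| / d.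
    rewrite normrM mulrAC [leRHS]mulrC ler_wpM2l//.
    rewrite ger0_norm; last by rewrite divr_ge0 ?sqr_ge0// addr_ge0// mulr_ge0// ltW.
    rewrite ler_pdivrMr ?exprn_gt0// mulrAC ler_pdivlMr//.
    by rewrite -subr_ge0 (_ : _ - _ = 3 * d + 2); [lra|ring].
  have -> : M / d = 2 * K / d + `|c1| / d + 2 * `|c2| / d by rewrite /M; ring.
  apply: le_trans (ler_normB _ _) _; apply: lerD => //.
  by apply: le_trans (ler_normB _ _) _; exact: lerD.
suff : (fun n : nat => n.+2%:R ^+ 2 * (u n.+3 - u n.+2)) @ \oo --> c1.
  move=> L; rewrite -(cvg_shiftn 2)/=.
  by under eq_fun do rewrite addn2.
apply/cvgrPdist_le => e e0; near=> n.
rewrite distrC (le_trans (HM n))// ler_pdivrMr//.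
rewrite mulrC -ler_pdivrMr//.
apply: (@le_trans _ _ n%:R); last by rewrite ler_nat leqW.
near: n; exact: nbhs_infty_ger.
Unshelve. all: end_near. Qed.

Lemma limit_constant (t : R) : 2 / pi * (cos_moment 4 (2 * t) / 180) =
  3 * Num.sqrt 6 * (1 - 24 * t ^+ 2 + 48 * t ^+ 4) /
      (20 * Num.sqrt pi * expR (6 * t ^+ 2)).
Proof.
rewrite cos_moment4E sqrtrM//.
have p0 : 0 < pi :> R by exact: pi_gt0.
have sp0 : Num.sqrt pi != 0 :> R by rewrite sqrtr_eq0 -ltNge.
rewrite -[X in 2 / X](sqr_sqrtr (ltW p0)).
by field; rewrite sp0 gt_eqF ?expR_gt0.
Qed.

End Limit.

Theorem theorem1p1 (R : realType) (I : nat -> R -> R)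
    (hI : forall (d : nat) (t : R), (0 < d)%N -> 0 <= t ->
      diagonal_section_volume d t (I d t))
    (t : R) (ht : 0 <= t) :
  (fun d : nat => d%:R ^+ 2 * (I d.+1 t - I d t)) @ \oo -->
    3 * Num.sqrt 6 * (1 - 24 * t ^+ 2 + 48 * t ^+ 4) /
      (20 * Num.sqrt pi * expR (6 * t ^+ 2)).
Proof.
have [c0 [c2 [K HK]]] := section_integral_expansion ht.
rewrite -limit_constant.
apply: (@cvg_of_expansion _ (I ^~ t) (2 / pi * c0) _ (2 / pi * c2) (2 / pi * K)) => n.
rewrite (section_volume_integral (hI n.+2 t isT ht)).
have p0 : 0 <= 2 / pi :> R by rewrite divr_ge0// pi_ge0.
move: (2 / pi) p0 => p p0.
have -> : p * section_integral n.+2 t - (p * c0 -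
    p * (cos_moment 4 (2 * t) / 180) / n.+2%:R + p * c2 / n.+2%:R ^+ 2) =
  p * (section_integral n.+2 t -
    (c0 - cos_moment 4 (2 * t) / 180 / n.+2%:R + c2 / n.+2%:R ^+ 2)) by ring.
by rewrite normrM ger0_norm// -[leRHS]mulrA ler_wpM2l.
Qed.
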